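(* Let $(\mathfrak g,d_{\mathfrak g},[\cdot,\cdot]_{\mathfrak g})$ and $(\mathfrak h,d_{\mathfrak h},[\cdot,\cdot]_{\mathfrak h})$ be strict Lie 2-algebras and let $\bar\mu:\mathfrak g\to\mathrm{SOut}(\mathfrak h)$ be an extensible homomorphism. Then the isomorphism classes of non-abelian extensions of $\mathfrak g$ by $\mathfrak h$ induced by $\bar\mu$ (that is, those whose induced homomorphism $\mathfrak g\to\mathrm{SOut}(\mathfrak h)$ is $\bar\mu$) are parameterized by (are in bijection with) $\mathcal H^2(\mathfrak g;\mathrm{Cen}(\mathfrak h))_{\hat\mu}$.
   Context: All vector spaces are over a fixed ground field $\mathbb K$. **Strict Lie 2-algebras.** A strict Lie 2-algebra is a graded vector space $\mathfrak g=\mathfrak g_1\oplus\mathfrak g_0$ with a linear map $d_{\mathfrak g}:\mathfrak g_1\to\mathfrak g_0$ and a skew-symmetric bilinear bracket $[\cdot,\cdot]_{\mathfrak g}:\mathfrak g_i\wedge\mathfrak g_j\to\mathfrak g_{i+j}$, $0\le i+j\le 1$ (so $[x,a]=-[a,x]$ for $x\in\mathfrak g_0,a\in\mathfrak g_1$), such that for $x,y,z\in\mathfrak g_0$, $a,b\in\mathfrak g_1$: $d[x,a]=[x,da]$; $[da,b]=[a,db]$; $[[x,y],z]+[[y,z],x]+[[z,x],y]=0$; $[[x,y],a]+[[y,a],x]+[[a,x],y]=0$. A strict homomorphism $f:\mathfrak g\to\mathfrak g'$ is a pair of linear maps $f_0:\mathfrak g_0\to\mathfrak g_0'$, $f_1:\mathfrak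 g_1\to\mathfrak g_1'$ with $d_{\mathfrak g'}f_1=f_0d_{\mathfrak g}$, $f_0[x,y]=[f_0x,f_0y]$, $f_1[x,a]=[f_0x,f_1a]$. **Endomorphisms.** For a 2-term complex $\mathbb V:V_1\xrightarrow{\partial}V_0$, the strict Lie 2-algebra $\mathrm{End}(\mathbb V)$ has degree-1 part $\mathrm{Hom}(V_0,V_1)$, degree-0 part $\{(X_0,X_1)\in\mathrm{End}(V_0)\oplus\mathrm{End}(V_1): X_0\partial=\partial X_1\}$, differential $\delta(D)=(\partial D,D\partial)$, and bracket $[(X_0,X_1),(Y_0,Y_1)]_C=([X_0,Y_0],[X_1,Y_1])$, $[(X_0,X_1),D]_C=X_1D-DX_0=-[D,(X_0,X_1)]_C$. A strict representation of $\mathfrak g$ on $\mathbb V$ is a strict homomorphism $\rho=(\rho_0,\rho_1):\mathfrak g\to\mathrm{End}(\mathbb V)$. **Derivations.** $\mathrm{SDer}(\mathfrak h)\subset\mathrm{End}(\mathfrak h)$ is the sub strict Lie 2-algebra with $\mathrm{SDer}^0(\mathfrak h)$ the degree-0 elements $(X_0,X_1)$ (so $X_0d_{\mathfrak h}=d_{\mathfrak h}X_1$) satisfying $X_0[u,v]=[X_0u,v]+[u,X_0v]$, $X_1[u,m]=[X_0u,m]+[u,X_1m]$, and $\mathrm{SDer}^1(\mathfrak h)$ the linear maps $\Theta:\mathfrak h_0\to\mathfrak h_1$ with $\Theta[u,v]=[\Theta u,v]+[u,\Theta v]$ ($u,v\in\mathfrak h_0$, $m\in\mathfrak h_1$). The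 adjoint homomorphism $\mathfrak h\to\mathrm{SDer}(\mathfrak h)$ is $\mathrm{ad}_0(u)=([u,\cdot]|_{\mathfrak h_0},[u,\cdot]|_{\mathfrak h_1})$, $\mathrm{ad}_1(m)(u)=[m,u]$. Its kernel is the center $\mathrm{Cen}(\mathfrak h)$: $\mathrm{Cen}^0(\mathfrak h)=\ker\mathrm{ad}_0$, $\mathrm{Cen}^1(\mathfrak h)=\ker\mathrm{ad}_1$, a 2-term complex under $d_{\mathfrak h}$. Its image $\mathrm{SInn}(\mathfrak h)$ is an ideal, and $\mathrm{SOut}(\mathfrak h)=\mathrm{SDer}(\mathfrak h)/\mathrm{SInn}(\mathfrak h)$ with quotient map $\pi=(\pi_0,\pi_1)$. **Cohomology.** For a strict representation $\rho$ of $\mathfrak g$ on $\mathbb V$, $$C^i(\mathfrak g;\mathbb V)=\bigoplus_{p+2q-s=i,\ p\ne i+1}\mathrm{Hom}(\wedge^p\mathfrak g_0\wedge\odot^q\mathfrak g_1,V_s),\quad s\in\{0,1\},$$ where $\wedge^p\mathfrak g_0\wedge\odot^q\mathfrak g_1$ means skew in the $\mathfrak g_0$-arguments and symmetric in the $\mathfrak g_1$-arguments. The coboundary is $D_\rho=\hat d_{\mathfrak g}+\hat\partial+d_\rho^{(0,1)}+d_\rho^{(1,0)}$, where for $f\in\mathrm{Hom}(\wedge^p\mathfrak g_0\wedge\odot^q\mathfrak g_1,V_s)$: $(\hat d_{\mathfrak g}f)(x_1,\dots,x_{p-1},a_1,\dots,a_{q+1})=(-1)^p\sum_i f(x_1,\dots,x_{p-1},d_{\mathfrak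 g}a_i,a_1,\dots,\widehat{a_i},\dots,a_{q+1})$; $\hat\partial f=(-1)^{p+2q}\partial\circ f$ (for $s=1$; zero for $s=0$); $(d_\rho^{(0,1)}f)(x_1,\dots,x_p,a_1,\dots,a_{q+1})=(-1)^p\sum_i\rho_1(a_i)f(x_1,\dots,x_p,a_1,\dots,\widehat{a_i},\dots,a_{q+1})$ (for $s=0$; zero for $s=1$); $(d_\rho^{(1,0)}f)(x_1,\dots,x_{p+1},a_1,\dots,a_q)=\sum_i(-1)^{i+1}\rho_0(x_i)f(\dots,\widehat{x_i},\dots)+\sum_{i<j}(-1)^{i+j}f([x_i,x_j],\dots,\widehat{x_i},\dots,\widehat{x_j},\dots,a_1,\dots,a_q)+\sum_{i,j}(-1)^if(x_1,\dots,\widehat{x_i},\dots,x_{p+1},a_1,\dots,[x_i,a_j],\dots,a_q)$. Cocycles, coboundaries, cohomology: $\mathcal Z^i,\mathcal B^i,\mathcal H^i(\mathfrak g;\mathbb V)_\rho=\mathcal Z^i/\mathcal B^i$. **Extensions.** A non-abelian extension of $\mathfrak g$ by $\mathfrak h$ is a strict Lie 2-algebra $\hat{\mathfrak g}$ with strict homomorphisms $i:\mathfrak h\to\hat{\mathfrak g}$, $p:\hat{\mathfrak g}\to\mathfrak g$ such that $0\to\mathfrak h_k\xrightarrow{i_k}\hat{\mathfrak g}_k\xrightarrow{p_k}\mathfrak g_k\to0$ is exact for $k=0,1$. Two extensions $(\hat{\mathfrak g},i,p)$, $(\tilde{\mathfrak g},j,q)$ are isomorphic if there is a strict homomorphism $F:\hat{\mathfrak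 g}\to\tilde{\mathfrak g}$ with $F\circ i=j$, $q\circ F=p$ (this is an equivalence relation). Given an extension, identify $\mathfrak h$ with $i(\mathfrak h)$, choose linear sections $\sigma_k:\mathfrak g_k\to\hat{\mathfrak g}_k$ of $p_k$, and put $\mu_0(x)=([\sigma_0(x),\cdot]|_{\mathfrak h_0},[\sigma_0(x),\cdot]|_{\mathfrak h_1})\in\mathrm{SDer}^0(\mathfrak h)$ and $\mu_1(a)=[\sigma_1(a),\cdot]|_{\mathfrak h_0}\in\mathrm{SDer}^1(\mathfrak h)$. Then $(\pi_0\circ\mu_0,\pi_1\circ\mu_1):\mathfrak g\to\mathrm{SOut}(\mathfrak h)$ is a strict homomorphism independent of $\sigma$, called the homomorphism induced by the extension; it depends only on the isomorphism class. **Lifting data, extensibility, $\hat\mu$.** Given a strict homomorphism $\bar\mu=(\bar\mu_0,\bar\mu_1):\mathfrak g\to\mathrm{SOut}(\mathfrak h)$, lifting data consist of linear sections $s=(s_0,s_1)$ of $\pi$, giving $\mu_0=s_0\bar\mu_0$, $\mu_0(x)=(\mu^0(x),\mu^1(x))$, and $\mu_1=s_1\bar\mu_1$, together with linear maps $\varphi:\mathfrak g_1\to\mathfrak h_0$, $\omega:\wedge^2\mathfrak g_0\to\mathfrak h_0$, $\nu:\mathfrak g_0\wedge\mathfrak g_1\to\mathfrak h_1$ (with $\nu(a,x)=-\nu(x,a)$) such that $\delta(\mu_1(a))-\mu_0(d_{\mathfrak g}a)=\mathrm{ad}_0(\varphi(a))$, $[\mu_0(x),\mu_0(y)]_C-\mu_0([x,y])=\mathrm{ad}_0(\omega(x,y))$,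 $[\mu_1(a),\mu_0(x)]_C-\mu_1([a,x])=\mathrm{ad}_1(\nu(a,x))$. $\bar\mu$ is called extensible if there exist lifting data such that, in addition, for all $x,y,z\in\mathfrak g_0$, $a,b\in\mathfrak g_1$: $\nu(d_{\mathfrak g}a,b)-\mu_1(b)\varphi(a)-\nu(a,d_{\mathfrak g}b)-\mu_1(a)\varphi(b)=0$; $\varphi([x,a])+d_{\mathfrak h}\nu(x,a)-\omega(x,d_{\mathfrak g}a)-\mu^0(x)\varphi(a)=0$; $\mu^0(x)\omega(y,z)-\omega([x,y],z)+$ cyclic permutations of $(x,y,z)$ $=0$; $\nu([x,y],a)+\nu([y,a],x)+\nu([a,x],y)-\mu^1(x)\nu(y,a)-\mu^1(y)\nu(a,x)-\mu_1(a)\omega(x,y)=0$. The maps $\hat\mu_0(x)=(\mu^0(x)|_{\mathrm{Cen}^0(\mathfrak h)},\mu^1(x)|_{\mathrm{Cen}^1(\mathfrak h)})$, $\hat\mu_1(a)=\mu_1(a)|_{\mathrm{Cen}^0(\mathfrak h)}$ define a strict representation $\hat\mu$ of $\mathfrak g$ on the complex $\mathrm{Cen}(\mathfrak h)$, depending only on $\bar\mu$. *)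

(* Defs.v *)
From HB Require Import structures.
From mathcomp Require Import all_boot all_order all_algebra.
From mathcomp Require Import boolp classical_sets functions.

Set Implicit Arguments.
Unset Strict Implicit.
Unset Printing Implicit Defensive.

Import GRing.Theory.
Local Open Scope ring_scope.

Section Subspace.
Variables (K : fieldType) (V : lmodType K).

Definition prop_pred (P : V -> Prop) : {pred V} := fun v => `[< P v >].

Lemma prop_predP (P : V -> Prop) v : reflect (P v) (v \in prop_pred P).
Proof. exact: asboolP. Qed.

Definition subspace_prop (P : V -> Prop) :=
  P 0 /\ forall (a : K) u v, P u -> P v -> P (a *: u + v).

Lemma prop_pred_submod (P : V -> Prop) :
  subspace_prop P -> submod_closed (prop_pred P).
Proof.
move=> [P0 PL]; split; first exact/prop_predP.
by move=> a u v /prop_predP Pu /prop_predP Pv; apply/prop_predP/PL.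
Qed.

Definition mksub (P : V -> Prop) (hP : subspace_prop P) : submodClosed V :=
  HB.pack (prop_pred P)
    (GRing.isSubmodClosed.Build K V (prop_pred P) (prop_pred_submod hP)).

Lemma mem_mksub (P : V -> Prop) (hP : subspace_prop P) v :
  reflect (P v) (v \in mksub hP).
Proof. exact: prop_predP. Qed.

Variable S : submodClosed V.

Definition sub_of := {v : V | v \in S}.
HB.instance Definition _ := Choice.on sub_of.
HB.instance Definition _ := SubChoice.on sub_of.
HB.instance Definition _ := [SubChoice_isSubLmodule of sub_of by <:].

Lemma val_lin (a : K) (u v : sub_of) : val (a *: u + v) = a *: val u + val v.
Proof. exact: linearP. Qed.

Fact submod_zmodClosed : zmod_closed S.
Proof.
split=> [|u v Su Sv]; first exact: rpred0.
by rewrite -[- v]scaleN1r rpredD ?rpredZ.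
Qed.

Definition zmodClosed_of : zmodClosed V :=
  HB.pack (mem S : {pred V}) (GRing.isZmodClosed.Build V (mem S) submod_zmodClosed).

Definition quot_of := Quotient.quot zmodClosed_of.
HB.instance Definition _ := GRing.Zmodule.on quot_of.
HB.instance Definition _ := EqQuotient.on quot_of.

Definition proj (v : V) : quot_of := (\pi_quot_of v)%qT.

Lemma projP u v : proj u = proj v <-> u - v \in S.
Proof.
have -> : (u - v \in S) = (proj u == proj v).
  exact: (@Quotient.idealrBE V zmodClosed_of).
by split=> [->|/eqP].
Qed.

Lemma reprP (x : quot_of) : proj (repr x) = x.
Proof. exact: reprK. Qed.

Lemma projD u v : proj (u + v) = proj u + proj v.
Proof. exact: (@Quotient.pi_add V zmodClosed_of). Qed.

Definition qscale (a : K) (x : quot_of) : quot_of := proj (a *: repr x).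

Lemma qscale_proj a v : qscale a (proj v) = proj (a *: v).
Proof.
apply/projP; rewrite -scalerBr rpredZ //.
by apply/projP; rewrite reprP.
Qed.

Fact qscaleA a b x : qscale a (qscale b x) = qscale (a * b) x.
Proof. by rewrite -[x]reprP !qscale_proj scalerA. Qed.
Fact qscale1 : left_id 1 qscale.
Proof. by move=> x; rewrite -[x]reprP !qscale_proj scale1r. Qed.
Fact qscaleDr : right_distributive qscale +%R.
Proof.
by move=> a x y; rewrite -[x]reprP -[y]reprP -projD !qscale_proj -projD scalerDr.
Qed.
Fact qscaleDl x : {morph qscale^~ x : a b / a + b}.
Proof. by move=> a b; rewrite -[x]reprP !qscale_proj -projD scalerDl. Qed.
HB.instance Definition _ := GRing.Zmodule_isLmodule.Build K quot_of
  qscaleA qscale1 qscaleDr qscaleDl.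

Fact proj_linear : linear proj.
Proof. by move=> a u v; rewrite projD -qscale_proj. Qed.
HB.instance Definition _ := GRing.isLinear.Build K V quot_of _ proj proj_linear.

End Subspace.
Arguments proj {K V S} v.

Section Hom.
Variables (K : fieldType) (U V : lmodType K).

Fact linear_subspace : subspace_prop (fun f : U -> V => linear f).
Proof.
split=> [a u v|a f g lf lg b u v]; rewrite ?fctE.
  by rewrite scaler0 addr0.
rewrite !(lf, lg).
rewrite !scalerDr !scalerA mulrC -!addrA; congr (_ + _).
by rewrite addrCA.
Qed.

Record hom := Hom {hom_fun :> U -> V; _ : hom_fun \in mksub linear_subspace}.
HB.instance Definition _ := [isSub for hom_fun].
HB.instance Definition _ := [Choice of hom by <:].
HB.instance Definition _ := [SubChoice_isSubLmodule of hom by <:].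

Fact hom_fun_linear (f : hom) : linear (hom_fun f).
Proof. exact: (elimT (mem_mksub linear_subspace _) (valP f)). Qed.
HB.instance Definition _ (f : hom) :=
  GRing.isLinear.Build K U V _ (hom_fun f) (hom_fun_linear f).

End Hom.

Section HomTheory.
Variables (K : fieldType) (U V : lmodType K).
Implicit Types f g : hom U V.

Lemma homP f g : (forall u, f u = g u) -> f = g.
Proof. by move=> fg; apply/val_inj/funext. Qed.
Lemma homDE f g u : (f + g) u = f u + g u.
Proof. by []. Qed.
Lemma homNE f u : (- f) u = - f u.
Proof. by []. Qed.
Lemma hom0E u : (0 : hom U V) u = 0.
Proof. by []. Qed.
Lemma homZE a f u : (a *: f) u = a *: f u.
Proof. by []. Qed.
Lemma homfD f u v : f (u + v) = f u + f v. Proof. exact: linearD. Qed.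
Lemma homfB f u v : f (u - v) = f u - f v. Proof. exact: linearB. Qed.
Lemma homfN f u : f (- u) = - f u. Proof. exact: linearN. Qed.
Lemma homf0 f : f 0 = 0. Proof. exact: linear0. Qed.
Lemma homfZ f a u : f (a *: u) = a *: f u. Proof. exact: linearZ. Qed.
Lemma homfP f a u v : f (a *: u + v) = a *: f u + f v. Proof. exact: linearP. Qed.
End HomTheory.

Record complex2 (K : fieldType) := Complex2 {
  deg0 : lmodType K;
  deg1 : lmodType K;
  diff : {linear deg1 -> deg0}
}.

Definition bilin (K : fieldType) (U V W : lmodType K) (b : U -> V -> W) :=
  (forall u, linear (b u)) /\ (forall v, linear (b^~ v)).

(* Value of a mixed-degree skew map on exchanged arguments: [a, x] = - [x, a],
   nu(a, x) = - nu(x, a). *)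
Definition flip (K : fieldType) (U V W : lmodType K) (b : U -> V -> W) :=
  fun v u => - b u v.

(* The bracket g_0 /\ g_0 -> g_0 is alternating, which is skew-symmetry when
   2 != 0 in K.  The bracket g_1 x g_0 -> g_1 is flip br1. *)
Record lie2 (K : fieldType) := Lie2 {
  lie2_complex :> complex2 K;
  br0 : deg0 lie2_complex -> deg0 lie2_complex -> deg0 lie2_complex;
  br1 : deg0 lie2_complex -> deg1 lie2_complex -> deg1 lie2_complex;
  br0_bilin : bilin br0;
  br1_bilin : bilin br1;
  br0_alt : forall x, br0 x x = 0;
  diff_br1 : forall x a, diff lie2_complex (br1 x a) = br0 x (diff lie2_complex a);
  br1_diff : forall a b,
    br1 (diff lie2_complex a) b = flip br1 a (diff lie2_complex b);
  br0_jacobi : forall x y z,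
    br0 (br0 x y) z + br0 (br0 y z) x + br0 (br0 z x) y = 0;
  br1_jacobi : forall x y a,
    br1 (br0 x y) a + flip br1 (br1 y a) x + flip br1 (flip br1 a x) y = 0
}.
Arguments br0 {K l}.
Arguments br1 {K l}.

Record lie2_hom (K : fieldType) (g g' : lie2 K) := Lie2Hom {
  hom0 : {linear deg0 g -> deg0 g'};
  hom1 : {linear deg1 g -> deg1 g'};
  hom_diff : forall a, diff g' (hom1 a) = hom0 (diff g a);
  hom_br0 : forall x y, hom0 (br0 x y) = br0 (hom0 x) (hom0 y);
  hom_br1 : forall x a, hom1 (br1 x a) = br1 (hom0 x) (hom1 a)
}.

Section BilinTheory.
Variables (K : fieldType) (U V W : lmodType K) (b : U -> V -> W).
Hypothesis hb : bilin b.
Lemma bilinDl u u' v : b (u + u') v = b u v + b u' v.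
Proof. by have := hb.2 v 1 u u'; rewrite !scale1r. Qed.
Lemma bilinDr u v v' : b u (v + v') = b u v + b u v'.
Proof. by have := hb.1 u 1 v v'; rewrite !scale1r. Qed.
Lemma bilin0l v : b 0 v = 0.
Proof. by apply: (@addrI _ (b 0 v)); rewrite -bilinDl !addr0. Qed.
Lemma bilin0r u : b u 0 = 0.
Proof. by apply: (@addrI _ (b u 0)); rewrite -bilinDr !addr0. Qed.
Lemma bilinNl u v : b (- u) v = - b u v.
Proof. by apply: (@addrI _ (b u v)); rewrite -bilinDl !subrr bilin0l. Qed.
Lemma bilinNr u v : b u (- v) = - b u v.
Proof. by apply: (@addrI _ (b u v)); rewrite -bilinDr !subrr bilin0r. Qed.
Lemma bilinBl u u' v : b (u - u') v = b u v - b u' v.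
Proof. by rewrite bilinDl bilinNl. Qed.
Lemma bilinBr u v v' : b u (v - v') = b u v - b u v'.
Proof. by rewrite bilinDr bilinNr. Qed.
Lemma bilinZl a u v : b (a *: u) v = a *: b u v.
Proof. by have := hb.2 v a u 0; rewrite bilin0l !addr0. Qed.
Lemma bilinZr a u v : b u (a *: v) = a *: b u v.
Proof. by have := hb.1 u a v 0; rewrite bilin0r !addr0. Qed.
End BilinTheory.

Lemma br0_skew (K : fieldType) (g : lie2 K) (x y : deg0 g) : br0 x y = - br0 y x.
Proof.
have bl := br0_bilin g; apply/eqP; rewrite -addr_eq0; apply/eqP.
have := br0_alt (x + y).
by rewrite (bilinDl bl) !(bilinDr bl) !br0_alt add0r addr0.
Qed.

Section SubComplex.
Variables (K : fieldType) (V : complex2 K).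
Variables (S0 : submodClosed (deg0 V)) (S1 : submodClosed (deg1 V)).
Hypothesis hd : forall a, a \in S1 -> diff V a \in S0.

Definition sub_diff (a : sub_of S1) : sub_of S0 :=
  exist _ (diff V (val a)) (hd (valP a)).
Fact sub_diff_linear : linear sub_diff.
Proof. by move=> k a b; apply: val_inj; rewrite /= linearP. Qed.
HB.instance Definition _ := GRing.isLinear.Build _ _ _ _ sub_diff sub_diff_linear.

Definition sub_complex : complex2 K := Complex2 sub_diff.
End SubComplex.

Section SubLie2.
Variables (K : fieldType) (L : lie2 K).
Variables (S0 : submodClosed (deg0 L)) (S1 : submodClosed (deg1 L)).
Hypothesis hd : forall a, a \in S1 -> diff L a \in S0.
Hypothesis h0 : forall x y, x \in S0 -> y \in S0 -> br0 x y \in S0.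
Hypothesis h1 : forall x a, x \in S0 -> a \in S1 -> br1 x a \in S1.

Definition sub_br0 (x y : sub_of S0) : sub_of S0 :=
  exist _ (br0 (val x) (val y)) (h0 (valP x) (valP y)).
Definition sub_br1 (x : sub_of S0) (a : sub_of S1) : sub_of S1 :=
  exist _ (br1 (val x) (val a)) (h1 (valP x) (valP a)).

Fact sub_br0_bilin : bilin sub_br0.
Proof.
split=> [x|y] k u v; apply: val_inj => /=; first exact: (br0_bilin L).1.
exact: (br0_bilin L).2.
Qed.
Fact sub_br1_bilin : bilin sub_br1.
Proof.
split=> [x|y] k u v; apply: val_inj => /=; first exact: (br1_bilin L).1.
exact: (br1_bilin L).2.
Qed.
Fact sub_br0_alt x : sub_br0 x x = 0.
Proof. by apply: val_inj; exact: br0_alt. Qed.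
Fact sub_diff_br1 x a : sub_diff hd (sub_br1 x a) = sub_br0 x (sub_diff hd a).
Proof. by apply: val_inj; exact: diff_br1. Qed.
Fact sub_br1_diff a b : sub_br1 (sub_diff hd a) b = flip sub_br1 a (sub_diff hd b).
Proof. by apply: val_inj; exact: br1_diff. Qed.
Fact sub_br0_jacobi x y z :
  sub_br0 (sub_br0 x y) z + sub_br0 (sub_br0 y z) x + sub_br0 (sub_br0 z x) y = 0.
Proof. by apply: val_inj; exact: br0_jacobi. Qed.
Fact sub_br1_jacobi x y a :
  sub_br1 (sub_br0 x y) a + flip sub_br1 (sub_br1 y a) x +
    flip sub_br1 (flip sub_br1 a x) y = 0.
Proof. by apply: val_inj; exact: br1_jacobi. Qed.

Definition sub_lie2 : lie2 K := @Lie2 K (sub_complex hd) sub_br0 sub_br1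
  sub_br0_bilin sub_br1_bilin sub_br0_alt sub_diff_br1 sub_br1_diff
  sub_br0_jacobi sub_br1_jacobi.
End SubLie2.

Section QuotLie2.
Variables (K : fieldType) (L : lie2 K).
Variables (I0 : submodClosed (deg0 L)) (I1 : submodClosed (deg1 L)).

Definition is_ideal := [/\ forall a, a \in I1 -> diff L a \in I0,
  forall x y, y \in I0 -> br0 x y \in I0,
  forall x a, a \in I1 -> br1 x a \in I1
  & forall x a, x \in I0 -> br1 x a \in I1].
Hypothesis hI : is_ideal.

Definition quot_diff (a : quot_of I1) : quot_of I0 := proj (diff L (repr a)).
Definition quot_br0 (x y : quot_of I0) : quot_of I0 :=
  proj (br0 (repr x) (repr y)).
Definition quot_br1 (x : quot_of I0) (a : quot_of I1) : quot_of I1 :=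
  proj (br1 (repr x) (repr a)).

Let repr_projB (V : lmodType K) (S : submodClosed V) (v : V) :
  repr (proj v : quot_of S) - v \in S.
Proof. by apply/projP; rewrite reprP. Qed.

Lemma quot_diff_proj a : quot_diff (proj a) = proj (diff L a).
Proof. by case: hI => hd _ _ _; apply/projP; rewrite -linearB; apply/hd/repr_projB. Qed.

Lemma quot_br0_proj x y : quot_br0 (proj x) (proj y) = proj (br0 x y).
Proof.
have bl := br0_bilin L; case: hI => _ h0 _ _; apply/projP.
rewrite -(subrKA (br0 x (repr (proj y : quot_of I0)))) rpredD //.
  rewrite -(bilinBl bl) br0_skew -(bilinNr (br0_bilin L)) h0 //.
  by rewrite -scaleN1r rpredZ // repr_projB.
by rewrite -(bilinBr bl) h0 // repr_projB.
Qed.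

Lemma quot_br1_proj x a : quot_br1 (proj x) (proj a) = proj (br1 x a).
Proof.
have bl := br1_bilin L; case: hI => _ _ h1 h2; apply/projP.
rewrite -(subrKA (br1 x (repr (proj a : quot_of I1)))) rpredD //.
  by rewrite -(bilinBl bl) h2 // repr_projB.
by rewrite -(bilinBr bl) h1 // repr_projB.
Qed.

Fact quot_diff_linear : linear quot_diff.
Proof.
move=> k a b; rewrite -[a]reprP -[b]reprP -linearP !quot_diff_proj.
by rewrite -linearP linearP.
Qed.
HB.instance Definition _ :=
  GRing.isLinear.Build _ _ _ _ quot_diff quot_diff_linear.

Let projE (V : lmodType K) (S : submodClosed V) (x : quot_of S) :
  exists v, x = proj v.
Proof. by exists (repr x); rewrite reprP. Qed.

Fact quot_br0_bilin : bilin quot_br0.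
Proof.
split=> [x|y] k u v /=; have [u' ->] := projE u; have [v' ->] := projE v.
  have [x' ->] := projE x.
  by rewrite -linearP !quot_br0_proj (br0_bilin L).1 linearP.
have [y' ->] := projE y.
by rewrite -linearP !quot_br0_proj -linearP; congr proj; apply: (br0_bilin L).2.
Qed.
Fact quot_br1_bilin : bilin quot_br1.
Proof.
split=> [x|y] k u v /=; have [u' ->] := projE u; have [v' ->] := projE v.
  have [x' ->] := projE x.
  by rewrite -linearP !quot_br1_proj (br1_bilin L).1 linearP.
have [y' ->] := projE y.
by rewrite -linearP !quot_br1_proj -linearP; congr proj; apply: (br1_bilin L).2.
Qed.
Fact quot_br0_alt x : quot_br0 x x = 0.
Proof. by have [x' ->] := projE x; rewrite quot_br0_proj br0_alt linear0. Qed.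
Fact quot_diff_br1 x a : quot_diff (quot_br1 x a) = quot_br0 x (quot_diff a).
Proof.
have [x' ->] := projE x; have [a' ->] := projE a.
by rewrite quot_br1_proj !quot_diff_proj quot_br0_proj diff_br1.
Qed.
Fact quot_br1_diff a b : quot_br1 (quot_diff a) b = flip quot_br1 a (quot_diff b).
Proof.
have [b' ->] := projE b; have [a' ->] := projE a.
by rewrite /flip !quot_diff_proj !quot_br1_proj -linearN br1_diff.
Qed.
Fact quot_br0_jacobi x y z :
  quot_br0 (quot_br0 x y) z + quot_br0 (quot_br0 y z) x +
    quot_br0 (quot_br0 z x) y = 0.
Proof.
have [x' ->] := projE x; have [y' ->] := projE y; have [z' ->] := projE z.
by rewrite !quot_br0_proj -!linearD br0_jacobi linear0.
Qed.
Fact quot_br1_jacobi x y a :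
  quot_br1 (quot_br0 x y) a + flip quot_br1 (quot_br1 y a) x +
    flip quot_br1 (flip quot_br1 a x) y = 0.
Proof.
have [x' ->] := projE x; have [y' ->] := projE y; have [a' ->] := projE a.
rewrite /flip quot_br0_proj !quot_br1_proj -[X in quot_br1 _ X]linearN.
by rewrite quot_br1_proj -!linearN -!linearD br1_jacobi linear0.
Qed.

Definition quot_lie2 : lie2 K := @Lie2 K (Complex2 quot_diff) quot_br0 quot_br1
  quot_br0_bilin quot_br1_bilin quot_br0_alt quot_diff_br1 quot_br1_diff
  quot_br0_jacobi quot_br1_jacobi.

Definition quot_hom : lie2_hom L quot_lie2 :=
  @Lie2Hom K L quot_lie2 proj proj quot_diff_proj
    (fun x y => esym (quot_br0_proj x y)) (fun x a => esym (quot_br1_proj x a)).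
End QuotLie2.

Definition lhom (K : fieldType) (U V : lmodType K) (f : U -> V) (lf : linear f) :
  hom U V := Hom (introT (mem_mksub (linear_subspace U V) f) lf).

Section Endomorphisms.
Variables (K : fieldType) (V : complex2 K).

Definition end0_prop (X : hom (deg0 V) (deg0 V) * hom (deg1 V) (deg1 V)) :=
  forall m, X.1 (diff V m) = diff V (X.2 m).
Fact end0_subspace : subspace_prop end0_prop.
Proof.
split=> [m|a X Y hX hY m]; first by rewrite /= linear0.
change (a *: X.1 (diff V m) + Y.1 (diff V m) =
  diff V (a *: X.2 m + Y.2 m)).
by rewrite hX hY linearP.
Qed.
Definition end0 := sub_of (mksub end0_subspace).
Definition act0 (X : end0) : hom (deg0 V) (deg0 V) := (val X).1.
Definition act1 (X : end0) : hom (deg1 V) (deg1 V) := (val X).2.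

Lemma act_diff (X : end0) m : act0 X (diff V m) = diff V (act1 X m).
Proof. exact: (elimT (mem_mksub end0_subspace _) (valP X)). Qed.

Lemma homLE (U W : lmodType K) (a : K) (f g : hom U W) u :
  (a *: f + g) u = a *: f u + g u.
Proof. by []. Qed.
Lemma act0_lin (a : K) (X Y : end0) u :
  act0 (a *: X + Y) u = a *: act0 X u + act0 Y u.
Proof. by rewrite /act0 (linearP (val : end0 -> _)). Qed.
Lemma act1_lin (a : K) (X Y : end0) u :
  act1 (a *: X + Y) u = a *: act1 X u + act1 Y u.
Proof. by rewrite /act1 (linearP (val : end0 -> _)). Qed.

Lemma end0P (X Y : end0) : act0 X =1 act0 Y -> act1 X =1 act1 Y -> X = Y.
Proof.
move=> e0 e1; apply: val_inj; rewrite [LHS]surjective_pairing.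
by rewrite [RHS]surjective_pairing; congr pair; apply: homP.
Qed.

Definition mkend0 (X0 : hom (deg0 V) (deg0 V)) (X1 : hom (deg1 V) (deg1 V))
  (hX : end0_prop (X0, X1)) : end0 :=
  exist _ (X0, X1) (introT (mem_mksub end0_subspace (X0, X1)) hX).

Fact delta_linear0 (D : hom (deg0 V) (deg1 V)) : linear (diff V \o D).
Proof. by move=> a u v; rewrite linearP. Qed.
Fact delta_linear1 (D : hom (deg0 V) (deg1 V)) : linear (D \o diff V).
Proof. by move=> a u v; rewrite linearP. Qed.
Definition delta (D : hom (deg0 V) (deg1 V)) : end0 :=
  @mkend0 (lhom (delta_linear0 D)) (lhom (delta_linear1 D)) (fun m => erefl).
Fact delta_linear : linear delta.
Proof.
move=> a D D'; apply: end0P => u.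
  by rewrite act0_lin [LHS]linearP.
by rewrite act1_lin.
Qed.
HB.instance Definition _ := GRing.isLinear.Build _ _ _ _ delta delta_linear.

Definition end_complex : complex2 K := Complex2 delta.

Let sub_lin (W : lmodType K) (a : K) (p q r t : W) :
  a *: p + q - (a *: r + t) = a *: (p - r) + (q - t).
Proof. by rewrite scalerBr opprD !addrA; congr (_ + _); rewrite addrAC. Qed.

Fact comm_linear (W : lmodType K) (f g : hom W W) :
  linear (fun w => f (g w) - g (f w)).
Proof. by move=> a u v; rewrite !(linearP f, linearP g) sub_lin. Qed.
Definition comm (W : lmodType K) (f g : hom W W) : hom W W :=
  lhom (comm_linear f g).

Fact end_br0_prop (X Y : end0) :
  end0_prop (comm (act0 X) (act0 Y), comm (act1 X) (act1 Y)).
Proof. by move=> m /=; rewrite !act_diff linearB. Qed.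
Definition end_br0 (X Y : end0) : end0 := mkend0 (end_br0_prop X Y).

Fact end_br1_linear (X : end0) (D : hom (deg0 V) (deg1 V)) :
  linear (fun u => act1 X (D u) - D (act0 X u)).
Proof.
by move=> a u v; rewrite !(linearP D, linearP (act0 X), linearP (act1 X)) sub_lin.
Qed.
Definition end_br1 (X : end0) (D : hom (deg0 V) (deg1 V)) :
  hom (deg0 V) (deg1 V) := lhom (end_br1_linear X D).

Lemma act0_br (X Y : end0) u :
  act0 (end_br0 X Y) u = act0 X (act0 Y u) - act0 Y (act0 X u).
Proof. by []. Qed.
Lemma act1_br (X Y : end0) u :
  act1 (end_br0 X Y) u = act1 X (act1 Y u) - act1 Y (act1 X u).
Proof. by []. Qed.
Lemma end_br1E (X : end0) (D : hom (deg0 V) (deg1 V)) u :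
  end_br1 X D u = act1 X (D u) - D (act0 X u).
Proof. by []. Qed.

Fact end_br0_bilin : bilin end_br0.
Proof.
split=> [X|Y] a U W; apply: end0P => u.
- by rewrite act0_lin !act0_br !act0_lin (linearP (act0 X)) sub_lin.
- by rewrite act1_lin !act1_br !act1_lin (linearP (act1 X)) sub_lin.
- by rewrite act0_lin !act0_br !act0_lin (linearP (act0 Y)) sub_lin.
- by rewrite act1_lin !act1_br !act1_lin (linearP (act1 Y)) sub_lin.
Qed.
Fact end_br1_bilin : bilin end_br1.
Proof.
split=> [X|D] a U W; apply: homP => u; rewrite homLE !end_br1E.
  by rewrite !homLE (linearP (act1 X)) sub_lin.
by rewrite act0_lin act1_lin (linearP D) sub_lin.
Qed.
Fact end_br0_alt X : end_br0 X X = 0.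
Proof. by apply: end0P => u /=; rewrite subrr. Qed.
Fact end_diff_br1 X D : delta (end_br1 X D) = end_br0 X (delta D).
Proof.
by apply: end0P => u /=; rewrite ?linearB /= ?act_diff.
Qed.
Fact end_br1_diff D D' :
  end_br1 (delta D) D' = flip end_br1 D (delta D').
Proof. by apply: homP => u /=; rewrite opprB. Qed.

Lemma act0D (X Y : end0) u : act0 (X + Y) u = act0 X u + act0 Y u.
Proof. by rewrite /act0 (raddfD (val : end0 -> _)). Qed.
Lemma act1D (X Y : end0) u : act1 (X + Y) u = act1 X u + act1 Y u.
Proof. by rewrite /act1 (raddfD (val : end0 -> _)). Qed.
Lemma act00 u : act0 0 u = 0.
Proof. by rewrite /act0 (raddf0 (val : end0 -> _)). Qed.
Lemma act10 u : act1 0 u = 0.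
Proof. by rewrite /act1 (raddf0 (val : end0 -> _)). Qed.

Let jacobi_cancel0 (W : zmodType) (a b c d e f : W) :
  (a - b - (c - d)) + (e - d - (a - f)) + (c - f - (e - b)) = 0.
Proof.
rewrite !opprB [LHS](AC (2*2*2) (1*6*3*2*5*4)) /=.
by rewrite !subrKA subrr.
Qed.
Let jacobi_cancel1 (W : zmodType) (a b c d e f : W) :
  (a - b - (c - d)) - (a - e - (f - d)) - (- (b - f) - - (e - c)) = 0.
Proof.
rewrite !opprB opprD !opprB [LHS](AC (2*2*2) (1*5*3*2*6*4)) /=.
by rewrite !subrKA subrr.
Qed.

Fact end_br0_jacobi X Y Z :
  end_br0 (end_br0 X Y) Z + end_br0 (end_br0 Y Z) X +
    end_br0 (end_br0 Z X) Y = 0.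
Proof.
apply: end0P => u.
  rewrite !act0D act00 !act0_br (linearB (act0 X)) (linearB (act0 Y)).
  by rewrite (linearB (act0 Z)); apply: jacobi_cancel0.
rewrite !act1D act10 !act1_br (linearB (act1 X)) (linearB (act1 Y)).
by rewrite (linearB (act1 Z)); apply: jacobi_cancel0.
Qed.
Fact end_br1_jacobi X Y D :
  end_br1 (end_br0 X Y) D + flip end_br1 (end_br1 Y D) X +
    flip end_br1 (flip end_br1 D X) Y = 0.
Proof.
apply: homP => u; rewrite !homDE hom0E /flip !homNE !end_br1E !homNE !end_br1E.
rewrite act0_br act1_br (linearB D) (linearB (act1 X)) linearN (linearB (act1 Y)).
exact: jacobi_cancel1.
Qed.

Definition Endo : lie2 K := @Lie2 K end_complex end_br0 end_br1
  end_br0_bilin end_br1_bilin end_br0_alt end_diff_br1 end_br1_diff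
  end_br0_jacobi end_br1_jacobi.
End Endomorphisms.

Section Der.
Variables (K : fieldType) (h : lie2 K).

Definition is_der0 (X : deg0 (Endo h)) :=
  (forall u v, act0 X (br0 u v) = br0 (act0 X u) v + br0 u (act0 X v)) /\
  (forall u m, act1 X (br1 u m) = br1 (act0 X u) m + br1 u (act1 X m)).
Definition is_der1 (T : deg1 (Endo h)) :=
  forall u v, T (br0 u v) = flip br1 (T u) v + br1 u (T v).

Let b0l := bilinDl (br0_bilin h).
Let b0r := bilinDr (br0_bilin h).
Let b1l := bilinDl (br1_bilin h).
Let b1r := bilinDr (br1_bilin h).

Let der_lin (W : lmodType K) (a : K) (p q r t : W) :
  a *: (p + q) + (r + t) = (a *: p + r) + (a *: q + t).
Proof. by rewrite scalerDr addrACA. Qed.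

Fact der0_subspace : subspace_prop is_der0.
Proof.
split=> [|a X Y [X0 X1] [Y0 Y1]].
  split=> u v; first by rewrite !act00 (bilin0l (br0_bilin h))
    (bilin0r (br0_bilin h)) addr0.
  by rewrite !act10 act00 (bilin0l (br1_bilin h)) (bilin0r (br1_bilin h)) addr0.
split=> u v.
  rewrite !act0_lin X0 Y0 b0l b0r (bilinZl (br0_bilin h)).
  by rewrite (bilinZr (br0_bilin h)) der_lin.
rewrite act0_lin !act1_lin X1 Y1 b1l b1r (bilinZl (br1_bilin h)).
by rewrite (bilinZr (br1_bilin h)) der_lin.
Qed.
Fact der1_subspace : subspace_prop is_der1.
Proof.
split=> [u v|a X Y X0 Y0 u v].
  by rewrite !hom0E /flip !(bilin0r (br1_bilin h)) oppr0 addr0.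
rewrite !homLE X0 Y0 /flip !b1r !(bilinZr (br1_bilin h)) der_lin.
by rewrite opprD scalerN.
Qed.
Definition Der0 := mksub der0_subspace.
Definition Der1 := mksub der1_subspace.

Fact der_diff T : T \in Der1 -> diff (Endo h) T \in Der0.
Proof.
move=> /mem_mksub hT; apply/mem_mksub; split=> u v.
  change (diff h (T (br0 u v)) = br0 (diff h (T u)) v + br0 u (diff h (T v))).
  by rewrite hT linearD /flip linearN !diff_br1 -br0_skew.
change (T (diff h (br1 u v)) = br1 (diff h (T u)) v + br1 u (T (diff h v))).
by rewrite diff_br1 hT br1_diff.
Qed.

Let der_comm (W : zmodType) (a b c d e f : W) :
  (a + b) + (c + d) - ((e + c) + (b + f)) = (a - e) + (d - f).
Proof.
rewrite !opprD [LHS](AC ((2*2)*(2*2)) ((1*5)*(4*8)*((2*7)*(3*6)))) /=.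
by rewrite !subrr !addr0.
Qed.

Fact der_br0 X Y : X \in Der0 -> Y \in Der0 -> end_br0 X Y \in Der0.
Proof.
move=> /mem_mksub[X0 X1] /mem_mksub[Y0 Y1]; apply/mem_mksub; split=> u v.
  rewrite !act0_br X0 Y0 (homfD (act0 X)) (homfD (act0 Y)) !X0 !Y0 der_comm.
  by rewrite (bilinBl (br0_bilin h)) (bilinBr (br0_bilin h)).
rewrite !act0_br !act1_br X1 Y1 (homfD (act1 X)) (homfD (act1 Y)) !X1 !Y1.
by rewrite der_comm (bilinBl (br1_bilin h)) (bilinBr (br1_bilin h)).
Qed.
Fact der_br1 X T : X \in Der0 -> T \in Der1 -> end_br1 X T \in Der1.
Proof.
move=> /mem_mksub[X0 X1] /mem_mksub hT; apply/mem_mksub => u v.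
rewrite !end_br1E hT X0 (homfD (act1 X)) (homfD T) !hT /flip.
rewrite (homfN (act1 X)) !X1 opprD [- _ - _]addrC der_comm.
by rewrite !(bilinBr (br1_bilin h)) opprB opprK [- _ + _]addrC.
Qed.

Definition SDer : lie2 K :=
  @sub_lie2 K (Endo h) Der0 Der1 der_diff der_br0 der_br1.

Definition der_act0 (X : deg0 SDer) : hom (deg0 h) (deg0 h) := act0 (val X).
Definition der_act1 (X : deg0 SDer) : hom (deg1 h) (deg1 h) := act1 (val X).
Definition der_map (T : deg1 SDer) : hom (deg0 h) (deg1 h) := val T.

Lemma jacobi0 (u v w : deg0 h) :
  br0 u (br0 v w) = br0 (br0 u v) w + br0 v (br0 u w).
Proof.
have := br0_jacobi u v w.
rewrite (br0_skew (br0 v w) u) (br0_skew (br0 w u) v) (br0_skew w u).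
rewrite (bilinNr (br0_bilin h)) opprK => J.
by apply/esym/eqP; rewrite -subr_eq0 -J addrAC.
Qed.
Lemma jacobi1 (u v : deg0 h) (m : deg1 h) :
  br1 u (br1 v m) = br1 (br0 u v) m + br1 v (br1 u m).
Proof.
have := br1_jacobi u v m; rewrite /flip (bilinNr (br1_bilin h)) opprK => J.
by apply/esym/eqP; rewrite -subr_eq0 -J addrAC.
Qed.

Fact ad0_prop u :
  end0_prop (V := h) (lhom ((br0_bilin h).1 u), lhom ((br1_bilin h).1 u)).
Proof. by move=> m /=; rewrite diff_br1. Qed.
Definition ad0_end (u : deg0 h) : deg0 (Endo h) := mkend0 (ad0_prop u).
Fact ad0_der u : ad0_end u \in Der0.
Proof. by apply/mem_mksub; split=> v w; [exact: jacobi0|exact: jacobi1]. Qed.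
Definition ad0 (u : deg0 h) : deg0 SDer := exist _ (ad0_end u) (ad0_der u).

Fact ad1_linear m : linear (flip (@br1 K h) m).
Proof.
by move=> a u v; rewrite /flip b1l (bilinZl (br1_bilin h)) opprD scalerN.
Qed.
Definition ad1_end (m : deg1 h) : deg1 (Endo h) := lhom (ad1_linear m).
Fact ad1_der m : ad1_end m \in Der1.
Proof.
apply/mem_mksub => u v; change (- br1 (br0 u v) m =
  - br1 v (- br1 u m) + br1 u (- br1 v m)).
by rewrite !(bilinNr (br1_bilin h)) opprK (jacobi1 u v) opprD addrCA subrr addr0.
Qed.
Definition ad1 (m : deg1 h) : deg1 SDer := exist _ (ad1_end m) (ad1_der m).

Lemma der0P (X Y : deg0 SDer) : der_act0 X =1 der_act0 Y ->
  der_act1 X =1 der_act1 Y -> X = Y.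
Proof. by move=> e0 e1; apply: val_inj; apply: end0P. Qed.
Lemma der1P (T T' : deg1 SDer) : der_map T =1 der_map T' -> T = T'.
Proof. by move=> e; apply: val_inj; apply: homP. Qed.
Lemma der_act0_lin (a : K) (X Y : deg0 SDer) u :
  der_act0 (a *: X + Y) u = a *: der_act0 X u + der_act0 Y u.
Proof. by rewrite /der_act0 (linearP (val : deg0 SDer -> _)) act0_lin. Qed.
Lemma der_act1_lin (a : K) (X Y : deg0 SDer) u :
  der_act1 (a *: X + Y) u = a *: der_act1 X u + der_act1 Y u.
Proof. by rewrite /der_act1 (linearP (val : deg0 SDer -> _)) act1_lin. Qed.
Lemma der_map_lin (a : K) (T T' : deg1 SDer) u :
  der_map (a *: T + T') u = a *: der_map T u + der_map T' u.
Proof. by rewrite /der_map (linearP (val : deg1 SDer -> _)) homLE. Qed.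
Lemma der_act_diff (X : deg0 SDer) m :
  der_act0 X (diff h m) = diff h (der_act1 X m).
Proof. exact: act_diff. Qed.
Lemma der_act0_br0 (X : deg0 SDer) u v :
  der_act0 X (br0 u v) = br0 (der_act0 X u) v + br0 u (der_act0 X v).
Proof. exact: (elimT (mem_mksub der0_subspace _) (valP X)).1. Qed.
Lemma der_act1_br1 (X : deg0 SDer) u m :
  der_act1 X (br1 u m) = br1 (der_act0 X u) m + br1 u (der_act1 X m).
Proof. exact: (elimT (mem_mksub der0_subspace _) (valP X)).2. Qed.
Lemma der_map_br0 (T : deg1 SDer) u v :
  der_map T (br0 u v) = flip br1 (der_map T u) v + br1 u (der_map T v).
Proof. exact: (elimT (mem_mksub der1_subspace _) (valP T)). Qed.
Lemma der_br0_act0 (X Y : deg0 SDer) u :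
  der_act0 (br0 X Y) u = der_act0 X (der_act0 Y u) - der_act0 Y (der_act0 X u).
Proof. by []. Qed.
Lemma der_br0_act1 (X Y : deg0 SDer) m :
  der_act1 (br0 X Y) m = der_act1 X (der_act1 Y m) - der_act1 Y (der_act1 X m).
Proof. by []. Qed.
Lemma der_br1_map (X : deg0 SDer) (T : deg1 SDer) u :
  der_map (br1 X T) u = der_act1 X (der_map T u) - der_map T (der_act0 X u).
Proof. by []. Qed.
Lemma der_diff_act0 (T : deg1 SDer) u :
  der_act0 (diff SDer T) u = diff h (der_map T u).
Proof. by []. Qed.
Lemma der_diff_act1 (T : deg1 SDer) m :
  der_act1 (diff SDer T) m = der_map T (diff h m).
Proof. by []. Qed.

Fact ad0_linear : linear ad0.
Proof.
move=> a u v; apply: der0P => w.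
  by rewrite der_act0_lin; apply: (br0_bilin h).2.
by rewrite der_act1_lin; apply: (br1_bilin h).2.
Qed.
HB.instance Definition _ := GRing.isLinear.Build _ _ _ _ ad0 ad0_linear.
Fact ad1_is_linear : linear ad1.
Proof.
move=> a u v; apply: der1P => w; rewrite der_map_lin.
change (- br1 w (a *: u + v) = a *: - br1 w u + - br1 w v).
by rewrite b1r (bilinZr (br1_bilin h)) opprD scalerN.
Qed.
HB.instance Definition _ := GRing.isLinear.Build _ _ _ _ ad1 ad1_is_linear.

Fact ad_diff m : diff SDer (ad1 m) = ad0 (diff h m).
Proof.
apply: der0P => v.
  change (diff h (- br1 v m) = br0 (diff h m) v).
  by rewrite linearN diff_br1 -br0_skew.
by rewrite [RHS]br1_diff.
Qed.
Fact ad_br0 u v : ad0 (br0 u v) = br0 (ad0 u) (ad0 v).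
Proof.
apply: der0P => w; apply/esym/eqP.
  by rewrite der_br0_act0 subr_eq; apply/eqP/jacobi0.
by rewrite der_br0_act1 subr_eq; apply/eqP/jacobi1.
Qed.
Fact der_ad1 (X : deg0 SDer) m : br1 X (ad1 m) = ad1 (der_act1 X m).
Proof.
apply: der1P => v; rewrite der_br1_map.
change (der_act1 X (- br1 v m) - (- br1 (der_act0 X v) m) =
  - br1 v (der_act1 X m)).
by rewrite homfN der_act1_br1 opprD opprK addrAC addNr add0r.
Qed.
Definition ad : lie2_hom h SDer :=
  @Lie2Hom K h SDer ad0 ad1 ad_diff ad_br0 (fun u m => esym (der_ad1 (ad0 u) m)).

Lemma der_ad0 (X : deg0 SDer) u : br0 X (ad0 u) = ad0 (der_act0 X u).
Proof.
apply: der0P => v; apply/eqP.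
  rewrite der_br0_act0 subr_eq; apply/eqP.
  exact: der_act0_br0.
rewrite der_br0_act1 subr_eq; apply/eqP.
exact: der_act1_br1.
Qed.
Lemma ad0_map u (T : deg1 SDer) : br1 (ad0 u) T = - ad1 (der_map T u).
Proof.
rewrite -[RHS]raddfN; apply: der1P => v; rewrite der_br1_map.
change (br1 u (der_map T v) - der_map T (br0 u v) = - br1 v (- der_map T u)).
rewrite der_map_br0 /flip (bilinNr (br1_bilin h)) opprK opprD opprK.
by rewrite addrCA subrr addr0.
Qed.

Definition is_inn0 (X : deg0 SDer) := exists u, X = hom0 ad u.
Definition is_inn1 (T : deg1 SDer) := exists m, T = hom1 ad m.
Fact inn0_subspace : subspace_prop is_inn0.
Proof.
split=> [|a _ _ [u ->] [v ->]]; first by exists 0; rewrite linear0.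
by exists (a *: u + v); rewrite linearP.
Qed.
Fact inn1_subspace : subspace_prop is_inn1.
Proof.
split=> [|a _ _ [u ->] [v ->]]; first by exists 0; rewrite linear0.
by exists (a *: u + v); rewrite linearP.
Qed.
Definition Inn0 := mksub inn0_subspace.
Definition Inn1 := mksub inn1_subspace.

Fact inn_ideal : is_ideal Inn0 Inn1.
Proof.
split=> [T|X T|X T|X T] /mem_mksub[u ->]; apply/mem_mksub.
- by exists (diff h u); exact: ad_diff.
- by exists (der_act0 X u); exact: der_ad0.
- by exists (der_act1 X u); exact: der_ad1.
by exists (- der_map T u); rewrite raddfN; exact: ad0_map.
Qed.
Definition SOut : lie2 K := quot_lie2 inn_ideal.
Definition pi : lie2_hom SDer SOut := quot_hom inn_ideal.

Definition is_cen0 (u : deg0 h) := hom0 ad u = 0.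
Definition is_cen1 (m : deg1 h) := hom1 ad m = 0.
Fact cen0_subspace : subspace_prop is_cen0.
Proof.
split=> [|a u v hu hv]; first exact: linear0.
by rewrite /is_cen0 linearP hu hv scaler0 addr0.
Qed.
Fact cen1_subspace : subspace_prop is_cen1.
Proof.
split=> [|a u v hu hv]; first exact: linear0.
by rewrite /is_cen1 linearP hu hv scaler0 addr0.
Qed.
Definition Cen0 := mksub cen0_subspace.
Definition Cen1 := mksub cen1_subspace.
Fact cen_diff m : m \in Cen1 -> diff h m \in Cen0.
Proof.
move=> /mem_mksub hm; apply/mem_mksub.
by rewrite /is_cen0 -hom_diff hm linear0.
Qed.
Definition Cen : complex2 K := sub_complex cen_diff.

Lemma cen0_act (X : deg0 SDer) u : u \in Cen0 -> der_act0 X u \in Cen0.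
Proof.
move=> /mem_mksub hu; have {}hu : ad0 u = 0 := hu; apply/mem_mksub.
change (ad0 (der_act0 X u) = 0).
by rewrite -der_ad0 hu (bilin0r (br0_bilin SDer)).
Qed.
Lemma cen1_act (X : deg0 SDer) m : m \in Cen1 -> der_act1 X m \in Cen1.
Proof.
move=> /mem_mksub hm; have {}hm : ad1 m = 0 := hm; apply/mem_mksub.
change (ad1 (der_act1 X m) = 0).
by rewrite -der_ad1 hm (bilin0r (br1_bilin SDer)).
Qed.
Lemma cen_map (T : deg1 SDer) u : u \in Cen0 -> der_map T u \in Cen1.
Proof.
move=> /mem_mksub hu; have {}hu : ad0 u = 0 := hu; apply/mem_mksub.
change (ad1 (der_map T u) = 0).
by rewrite -[LHS]opprK -ad0_map hu (bilin0l (br1_bilin SDer)) oppr0.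
Qed.

Definition res_fun0 (X : deg0 SDer) (c : deg0 Cen) : deg0 Cen :=
  exist _ (der_act0 X (val c)) (cen0_act X (valP c)).
Definition res_fun1 (X : deg0 SDer) (c : deg1 Cen) : deg1 Cen :=
  exist _ (der_act1 X (val c)) (cen1_act X (valP c)).
Definition res_map (T : deg1 SDer) (c : deg0 Cen) : deg1 Cen :=
  exist _ (der_map T (val c)) (cen_map T (valP c)).
Fact res_fun0_linear X : linear (res_fun0 X).
Proof. by move=> a u v; apply: val_inj; rewrite /= linearP. Qed.
Fact res_fun1_linear X : linear (res_fun1 X).
Proof. by move=> a u v; apply: val_inj; rewrite /= linearP. Qed.
Fact res_map_linear T : linear (res_map T).
Proof. by move=> a u v; apply: val_inj; rewrite /= linearP. Qed.
Fact res0_prop X :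
  end0_prop (V := Cen) (lhom (res_fun0_linear X), lhom (res_fun1_linear X)).
Proof. by move=> c; apply: val_inj; exact: der_act_diff. Qed.

Definition res0 (X : deg0 SDer) : deg0 (Endo Cen) := mkend0 (res0_prop X).
Definition res1 (T : deg1 SDer) : deg1 (Endo Cen) := lhom (res_map_linear T).

Fact res0_linear : linear res0.
Proof.
move=> a X Y; apply: end0P => c; rewrite ?act0_lin ?act1_lin; apply: val_inj.
  exact: der_act0_lin.
exact: der_act1_lin.
Qed.
HB.instance Definition _ := GRing.isLinear.Build _ _ _ _ res0 res0_linear.
Fact res1_linear : linear res1.
Proof.
by move=> a X Y; apply: homP => c; rewrite homLE; apply: val_inj; exact: der_map_lin.
Qed.
HB.instance Definition _ := GRing.isLinear.Build _ _ _ _ res1 res1_linear.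
Fact res_diff T : diff (Endo Cen) (res1 T) = res0 (diff SDer T).
Proof. by apply: end0P => c; apply: val_inj. Qed.
Fact res_br0 X Y : res0 (br0 X Y) = br0 (res0 X) (res0 Y).
Proof. by apply: end0P => c; apply: val_inj. Qed.
Fact res_br1 X T : res1 (br1 X T) = br1 (res0 X) (res1 T).
Proof. by apply: homP => c; apply: val_inj. Qed.
Definition res : lie2_hom SDer (Endo Cen) :=
  @Lie2Hom K SDer (Endo Cen) res0 res1 res_diff res_br0 res_br1.

Lemma res_ad0 u : hom0 res (hom0 ad u) = 0.
Proof.
apply: end0P => c; rewrite ?act00 ?act10; apply: val_inj.
  change (br0 u (val c) = 0); rewrite br0_skew; apply/eqP; rewrite oppr_eq0.
  have /mem_mksub hc := valP c; apply/eqP.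
  by have := congr1 (fun X => der_act0 X u) hc; rewrite /der_act0 act00.
change (br1 u (val c) = 0).
have /mem_mksub hc := valP c; apply: oppr_inj; rewrite oppr0.
by have := congr1 (fun X => der_map X u) hc; rewrite /der_map hom0E.
Qed.
Lemma res_ad1 m : hom1 res (hom1 ad m) = 0.
Proof.
apply: homP => c; rewrite hom0E; apply: val_inj.
change (- br1 (val c) m = 0); apply/eqP; rewrite oppr_eq0; apply/eqP.
have /mem_mksub hc := valP c.
by have := congr1 (fun X => der_act1 X m) hc; rewrite /der_act1 act10.
Qed.
End Der.

Section Cohomology.
Variables (K : fieldType) (g : lie2 K) (V : complex2 K) (rho : lie2_hom g (Endo V)).

(* A cochain is a pair (f.1, f.2), f.1 with values in V_0 and f.2 in V_1.  The
   component of f.s in Hom(/\^p g_0 /\ (.)^q g_1, V_s) is the restriction of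
   f.s to pairs of sequences of sizes p and q, so the direct sum over (p, q)
   is a space of functions on pairs of sequences with a support condition. *)
Definition form (W : lmodType K) := seq (deg0 g) -> seq (deg1 g) -> W.
Definition cochain := (form (deg0 V) * form (deg1 V))%type.

Definition is_form (W : lmodType K) (F : form W) :=
  [/\ forall l r ys, linear (fun x => F (l ++ x :: r) ys),
      forall xs l r, linear (fun a => F xs (l ++ a :: r)),
      forall l m r x ys, F (l ++ x :: m ++ x :: r) ys = 0
    & forall xs ys ys', perm_eq ys ys' -> F xs ys = F xs ys'].

Definition supported (W : lmodType K) (i s : nat) (F : form W) :=
  forall xs ys,
    ~~ ((size xs + 2 * size ys == i + s)%N && (size xs != i.+1)) -> F xs ys = 0.

Definition is_cochain (i : nat) (f : cochain) :=
  [/\ is_form f.1, is_form f.2, supported i 0 f.1 & supported i 1 f.2].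

Definition del (T : Type) (i : nat) (s : seq T) := take i s ++ drop i.+1 s.

Section Operators.
Variable W : lmodType K.
Implicit Types (F : form W) (xs : seq (deg0 g)) (ys : seq (deg1 g)).

(* Here and below the sign exponents are written in terms of the arguments of
   the result, with indices starting at 0. *)
Definition dhat F : form W := fun xs ys =>
  (-1) ^+ (size xs).+1 *:
    \sum_(i < size ys) F (rcons xs (diff g ys`_i)) (del i ys).

Definition d10 (R : deg0 g -> W -> W) F : form W := fun xs ys =>
  \sum_(i < size xs) (-1) ^+ i *: R xs`_i (F (del i xs) ys) +
  \sum_(i < size xs) \sum_(j < size xs | (i < j)%N)
    (-1) ^+ (i + j) *: F (br0 xs`_i xs`_j :: del i (del j xs)) ys +
  \sum_(i < size xs) \sum_(j < size ys)
    (-1) ^+ i.+1 *: F (del i xs) (set_nth 0 ys j (br1 xs`_i ys`_j)).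

Let sum_lin (I : finType) (P : pred I) (a : K) (u v : I -> W) :
  \sum_(i | P i) (a *: u i + v i) =
    a *: (\sum_(i | P i) u i) + \sum_(i | P i) v i.
Proof. by rewrite big_split scaler_sumr. Qed.
Let scale_lin (a c : K) (u v : W) : c *: (a *: u + v) = a *: (c *: u) + c *: v.
Proof. by rewrite scalerDr !scalerA mulrC. Qed.

Fact dhat_linear : linear dhat.
Proof.
move=> a F G; apply/funext => xs; apply/funext => ys.
change (dhat (a *: F + G) xs ys = a *: dhat F xs ys + dhat G xs ys).
by rewrite /dhat sum_lin scale_lin.
Qed.

Fact d10_linear R : (forall x, linear (R x)) -> linear (d10 R).
Proof.
move=> lR a F G; apply/funext => xs; apply/funext => ys.
change (d10 R (a *: F + G) xs ys = a *: d10 R F xs ys + d10 R G xs ys).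
rewrite /d10 !scalerDr addrACA [X in _ = X + _]addrACA.
congr (_ + _ + _).
- rewrite -sum_lin; apply: eq_bigr => i _; rewrite -scale_lin -lR //.
- rewrite -sum_lin; apply: eq_bigr => i _; rewrite -sum_lin.
  by apply: eq_bigr => j _; rewrite -scale_lin.
rewrite -sum_lin; apply: eq_bigr => i _; rewrite -sum_lin.
by apply: eq_bigr => j _; rewrite -scale_lin.
Qed.
End Operators.

Definition dpartial (F : form (deg1 V)) : form (deg0 V) := fun xs ys =>
  (-1) ^+ (size xs + 2 * size ys)%N *: diff V (F xs ys).

Definition d01 (F : form (deg0 V)) : form (deg1 V) := fun xs ys =>
  (-1) ^+ size xs *: \sum_(i < size ys) hom1 rho ys`_i (F xs (del i ys)).

Definition coboundary (f : cochain) : cochain :=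
  (dhat f.1 + dpartial f.2 + d10 (fun x => act0 (hom0 rho x)) f.1,
   dhat f.2 + d01 f.1 + d10 (fun x => act1 (hom0 rho x)) f.2).

Fact dpartial_linear : linear dpartial.
Proof.
move=> a F G; apply/funext => xs; apply/funext => ys.
change (dpartial (a *: F + G) xs ys = a *: dpartial F xs ys + dpartial G xs ys).
by rewrite /dpartial [diff V _]linearP scalerDr !scalerA mulrC.
Qed.
Fact d01_linear : linear d01.
Proof.
move=> a F G; apply/funext => xs; apply/funext => ys.
change (d01 (a *: F + G) xs ys = a *: d01 F xs ys + d01 G xs ys).
rewrite /d01 scalerA mulrC -scalerA -scalerDr; congr (_ *: _).
rewrite scaler_sumr -big_split /=; apply: eq_bigr => i _; exact: homfP.
Qed.
Fact coboundary_linear : linear coboundary.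
Proof.
move=> a f e; congr pair.
  change (dhat (a *: f.1 + e.1) + dpartial (a *: f.2 + e.2) +
    d10 (fun x => act0 (hom0 rho x)) (a *: f.1 + e.1) = a *: (coboundary f).1 +
    (coboundary e).1).
  rewrite dhat_linear dpartial_linear d10_linear => [|x]; last exact: homfP.
  by rewrite /= !scalerDr [LHS](AC ((2*2)*2) ((1*3*5)*(2*4*6))).
change (dhat (a *: f.2 + e.2) + d01 (a *: f.1 + e.1) +
  d10 (fun x => act1 (hom0 rho x)) (a *: f.2 + e.2) = a *: (coboundary f).2 +
  (coboundary e).2).
rewrite dhat_linear d01_linear d10_linear => [|x]; last exact: homfP.
by rewrite /= !scalerDr [LHS](AC ((2*2)*2) ((1*3*5)*(2*4*6))).
Qed.
HB.instance Definition _ :=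
  GRing.isLinear.Build K cochain cochain _ coboundary coboundary_linear.

Fact is_form_lin (W : lmodType K) (a : K) (F G : form W) :
  is_form F -> is_form G -> is_form (a *: F + G).
Proof.
have E xs ys : (a *: F + G) xs ys = a *: F xs ys + G xs ys by [].
have L b (p q r t : W) :
    a *: (b *: p + q) + (b *: r + t) = b *: (a *: p + r) + (a *: q + t).
  by rewrite !scalerDr !scalerA [a * b]mulrC addrACA.
move=> [F1 F2 F3 F4] [G1 G2 G3 G4]; split.
- by move=> l r ys b u v; rewrite !E F1 G1 L.
- by move=> xs l r b u v; rewrite !E F2 G2 L.
- by move=> l m r x ys; rewrite E F3 G3 scaler0 addr0.
by move=> xs ys ys' p; rewrite !E (F4 _ _ _ p) (G4 _ _ _ p).
Qed.
Fact is_form0 (W : lmodType K) : is_form (0 : form W).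
Proof.
have E xs ys : (0 : form W) xs ys = 0 by [].
by split=> // [l r ys|xs l r] b u v; rewrite !E scaler0 addr0.
Qed.

Fact cochain_subspace i : subspace_prop (is_cochain i).
Proof.
split; first by split=> //; exact: is_form0.
move=> a f e [f1 f2 f3 f4] [e1 e2 e3 e4]; split; try exact: is_form_lin.
  move=> xs ys hs; change (a *: f.1 xs ys + e.1 xs ys = 0).
  by rewrite f3 // e3 // scaler0 addr0.
move=> xs ys hs; change (a *: f.2 xs ys + e.2 xs ys = 0).
by rewrite f4 // e4 // scaler0 addr0.
Qed.

Definition is_cocycle (i : nat) (f : cochain) :=
  is_cochain i f /\ coboundary f = 0.
Fact cocycle_subspace i : subspace_prop (is_cocycle i).
Proof.
split; first by split; [exact: (cochain_subspace i).1|exact: linear0].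
move=> a f e [f1 f2] [e1 e2]; split; first exact: (cochain_subspace i).2.
by rewrite coboundary_linear f2 e2 scaler0 addr0.
Qed.
Definition cocycle (i : nat) := sub_of (mksub (cocycle_subspace i)).

(* As coboundary \o coboundary = 0, restricting to coboundaries that are cocycles
   is no loss.  There are no cochains of degree -1. *)
Definition is_coboundary (i : nat) (f : cocycle i) :=
  if i is j.+1 then exists2 e, is_cochain j e & val f = coboundary e
  else val f = 0.
Fact coboundary_subspace i : subspace_prop (@is_coboundary i).
Proof.
case: i => [|i]; split => //.
- move=> a f e; rewrite /is_coboundary val_lin.
  by move=> -> ->; rewrite scaler0 addr0.
- exists 0; first exact: (cochain_subspace i).1.
  by rewrite [RHS]linear0 [LHS](raddf0 (val : cocycle i.+1 -> _)).
move=> a f e [f' hf ef] [e' he ee]; exists (a *: f' + e').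
  exact: (cochain_subspace i).2.
by rewrite coboundary_linear -ef -ee val_lin.
Qed.

Definition cohomology (i : nat) := quot_of (mksub (coboundary_subspace i)).
End Cohomology.

Section Extensions.
Variables (K : fieldType) (g h : lie2 K).

Record extension := Extension {
  ext_tot :> lie2 K;
  ext_inc : lie2_hom h ext_tot;
  ext_prj : lie2_hom ext_tot g;
  ext_inj0 : injective (hom0 ext_inc);
  ext_inj1 : injective (hom1 ext_inc);
  ext_exact0 : forall e, hom0 ext_prj e = 0 <-> exists u, hom0 ext_inc u = e;
  ext_exact1 : forall e, hom1 ext_prj e = 0 <-> exists m, hom1 ext_inc m = e;
  ext_surj0 : forall x, exists e, hom0 ext_prj e = x;
  ext_surj1 : forall a, exists e, hom1 ext_prj e = a
}.

Definition ext_iso (E E' : extension) := exists F : lie2_hom E E',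
  [/\ forall u, hom0 F (hom0 (ext_inc E) u) = hom0 (ext_inc E') u,
      forall m, hom1 F (hom1 (ext_inc E) m) = hom1 (ext_inc E') m,
      forall e, hom0 (ext_prj E') (hom0 F e) = hom0 (ext_prj E) e
    & forall e, hom1 (ext_prj E') (hom1 F e) = hom1 (ext_prj E) e].

(* (mu0, mu1) is ([s0 x, .], [s1 a, .]) restricted to h, h being identified
   with its image under the injection ext_inc E. *)
Definition restricted_ad (E : extension)
    (s0 : deg0 g -> deg0 E) (s1 : deg1 g -> deg1 E)
    (mu0 : deg0 g -> deg0 (SDer h)) (mu1 : deg1 g -> deg1 (SDer h)) :=
  [/\ forall x v, hom0 (ext_inc E) (der_act0 (mu0 x) v) =
        br0 (s0 x) (hom0 (ext_inc E) v),
      forall x m, hom1 (ext_inc E) (der_act1 (mu0 x) m) =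
        br1 (s0 x) (hom1 (ext_inc E) m)
    & forall a v, hom1 (ext_inc E) (der_map (mu1 a) v) =
        flip br1 (s1 a) (hom0 (ext_inc E) v)].

Variable mubar : lie2_hom g (SOut h).

(* The homomorphism g -> SOut h does not depend on the sections, so that "some
   sections" may be read as "all sections". *)
Definition induces (E : extension) :=
  exists (s0 : {linear deg0 g -> deg0 E}) (s1 : {linear deg1 g -> deg1 E})
    (mu0 : deg0 g -> deg0 (SDer h)) (mu1 : deg1 g -> deg1 (SDer h)),
  [/\ cancel s0 (hom0 (ext_prj E)) /\ cancel s1 (hom1 (ext_prj E)),
      restricted_ad s0 s1 mu0 mu1,
      forall x, hom0 (pi h) (mu0 x) = hom0 mubar x
    & forall a, hom1 (pi h) (mu1 a) = hom1 mubar a].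

(* An isomorphism class is the set of all extensions isomorphic to a given one;
   classical_sets.set is too low in the universe hierarchy to hold it. *)
Definition ext_class :=
  {C : extension -> Prop | exists2 E, induces E & C = ext_iso E}.

Record pi_section := PiSection {
  sec0 : {linear deg0 (SOut h) -> deg0 (SDer h)};
  sec1 : {linear deg1 (SOut h) -> deg1 (SDer h)};
  sec0K : cancel sec0 (hom0 (pi h));
  sec1K : cancel sec1 (hom1 (pi h))
}.

Section Lift.
Variable s : pi_section.

Definition mu0 (x : deg0 g) : deg0 (SDer h) := sec0 s (hom0 mubar x).
Definition mu1 (a : deg1 g) : deg1 (SDer h) := sec1 s (hom1 mubar a).

Fact mu0_linear : linear mu0.
Proof. by move=> a x y; rewrite /mu0 !linearP. Qed.
Fact mu1_linear : linear mu1.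
Proof. by move=> a x y; rewrite /mu1 !linearP. Qed.
HB.instance Definition _ := GRing.isLinear.Build _ _ _ _ mu0 mu0_linear.
HB.instance Definition _ := GRing.isLinear.Build _ _ _ _ mu1 mu1_linear.

Lemma pi_mu0 x : hom0 (pi h) (mu0 x) = hom0 mubar x.
Proof. exact: sec0K. Qed.
Lemma pi_mu1 a : hom1 (pi h) (mu1 a) = hom1 mubar a.
Proof. exact: sec1K. Qed.

Lemma res_pi0 X Y : hom0 (pi h) X = hom0 (pi h) Y -> hom0 (res h) X = hom0 (res h) Y.
Proof.
move/projP/mem_mksub => [u XY]; apply/eqP; rewrite -subr_eq0 -linearB XY.
by apply/eqP; exact: res_ad0.
Qed.
Lemma res_pi1 X Y : hom1 (pi h) X = hom1 (pi h) Y -> hom1 (res h) X = hom1 (res h) Y.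
Proof.
move/projP/mem_mksub => [u XY]; apply/eqP; rewrite -subr_eq0 -linearB XY.
by apply/eqP; exact: res_ad1.
Qed.

Definition hatmu0 (x : deg0 g) : deg0 (Endo (Cen h)) := hom0 (res h) (mu0 x).
Definition hatmu1 (a : deg1 g) : deg1 (Endo (Cen h)) := hom1 (res h) (mu1 a).

Fact hatmu0_linear : linear hatmu0.
Proof. by move=> a x y; rewrite /hatmu0 !linearP. Qed.
Fact hatmu1_linear : linear hatmu1.
Proof. by move=> a x y; rewrite /hatmu1 !linearP. Qed.
HB.instance Definition _ := GRing.isLinear.Build _ _ _ _ hatmu0 hatmu0_linear.
HB.instance Definition _ := GRing.isLinear.Build _ _ _ _ hatmu1 hatmu1_linear.

Fact hatmu_diff a : diff (Endo (Cen h)) (hatmu1 a) = hatmu0 (diff g a).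
Proof.
rewrite /hatmu1 hom_diff; apply: res_pi0.
by rewrite -hom_diff pi_mu0 pi_mu1 hom_diff.
Qed.
Fact hatmu_br0 x y : hatmu0 (br0 x y) = br0 (hatmu0 x) (hatmu0 y).
Proof.
rewrite /hatmu0 -hom_br0; apply: res_pi0.
by rewrite hom_br0 !pi_mu0 hom_br0.
Qed.
Fact hatmu_br1 x a : hatmu1 (br1 x a) = br1 (hatmu0 x) (hatmu1 a).
Proof.
rewrite /hatmu0 /hatmu1 -hom_br1; apply: res_pi1.
by rewrite hom_br1 pi_mu0 !pi_mu1 hom_br1.
Qed.
Definition hatmu : lie2_hom g (Endo (Cen h)) :=
  @Lie2Hom K g (Endo (Cen h)) hatmu0 hatmu1 hatmu_diff hatmu_br0 hatmu_br1.
End Lift.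

Lemma hatmu0_indep (s s' : pi_section) x : hom0 (hatmu s) x = hom0 (hatmu s') x.
Proof. by apply: res_pi0; rewrite !pi_mu0. Qed.
Lemma hatmu1_indep (s s' : pi_section) a : hom1 (hatmu s) a = hom1 (hatmu s') a.
Proof. by apply: res_pi1; rewrite !pi_mu1. Qed.

Record lifting_data := LiftingData {
  lift_sec : pi_section;
  phi : {linear deg1 g -> deg0 h};
  omega : deg0 g -> deg0 g -> deg0 h;
  nu : deg0 g -> deg1 g -> deg1 h;
  omega_bilin : bilin omega;
  omega_alt : forall x, omega x x = 0;
  nu_bilin : bilin nu;
  phiP : forall a, diff (SDer h) (mu1 lift_sec a) - mu0 lift_sec (diff g a) =
    hom0 (ad h) (phi a);
  omegaP : forall x y,
    br0 (mu0 lift_sec x) (mu0 lift_sec y) - mu0 lift_sec (br0 x y) =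
    hom0 (ad h) (omega x y);
  nuP : forall a x,
    flip br1 (mu1 lift_sec a) (mu0 lift_sec x) - mu1 lift_sec (flip br1 a x) =
    hom1 (ad h) (flip nu a x)
}.

Definition extensible := exists L : lifting_data,
  let m0 x := der_act0 (mu0 (lift_sec L) x) in
  let m1 x := der_act1 (mu0 (lift_sec L) x) in
  let m a := der_map (mu1 (lift_sec L) a) in
  let phi := phi L in let omega := omega L in
  let nu := nu L in let nu' := flip nu in
  [/\ forall a b, nu (diff g a) b - m b (phi a) - nu' a (diff g b) -
        m a (phi b) = 0,
      forall x a, phi (br1 x a) + diff h (nu x a) - omega x (diff g a) -
        m0 x (phi a) = 0,
      forall x y z, (m0 x (omega y z) - omega (br0 x y) z) +
        (m0 y (omega z x) - omega (br0 y z) x) +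
        (m0 z (omega x y) - omega (br0 z x) y) = 0
    & forall x y a, nu (br0 x y) a + nu' (br1 y a) x + nu' (flip br1 a x) y -
        m1 x (nu y a) - m1 y (nu' a x) - m a (omega x y) = 0].
End Extensions.

(* Main.v *)
From HB Require Import structures.
Require Import Defs.
From mathcomp Require Import all_boot all_algebra.
From mathcomp Require Import zify.
From mathcomp Require Import boolp classical_sets functions.

(* The lifting data make the curvature of (mu_0, mu_1) inner, with potentials
   (phi, omega, nu), and extensibility says that these potentials satisfy a
   twisted cocycle condition.  Such a triple is a factor set: it defines a strict
   Lie 2-algebra structure on g + h.  Conversely, the sections of an extension
   inducing mubar can be corrected by linear maps into h so that they act on h
   exactly by (mu_0, mu_1), and their defect is then a factor set for the same
   (mu_0, mu_1).  The curvature equations determine factor sets up to values in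
   the center, where the twisted cocycle condition is linear and is precisely the
   condition of being a 2-cocycle; thus factor sets form a torsor under Z^2.  An
   isomorphism of two such extensions is the identity of g + h plus a linear map
   g -> h, which is forced to be central, and it exhibits the difference of the
   factor sets as the coboundary of that map. *)

Set Implicit Arguments.
Unset Strict Implicit.
Unset Printing Implicit Defensive.

Import GRing.Theory.
Local Open Scope ring_scope.

(** * Abelian group identities and linear lifts *)

Section AbelianNormalization.

(** Syntax of abelian group expressions. Once brackets are expanded by bilinearity, most
    verifications below come down to identities valid in every abelian group, which are decided by
    computing integer coefficients. *)
Inductive zterm := ZVar of nat | ZZero | ZAdd of zterm & zterm | ZOpp of zterm.

Fixpoint zeval (A : zmodType) (e : seq A) t :=
  match t with
  | ZVar i => nth 0 e i
  | ZZero => 0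
  | ZAdd t u => zeval e t + zeval e u
  | ZOpp t => - zeval e t
  end.

Fixpoint zcoef (i : nat) t : int :=
  match t with
  | ZVar j => (i == j)%:R
  | ZZero => 0
  | ZAdd t u => zcoef i t + zcoef i u
  | ZOpp t => - zcoef i t
  end.

(** A variable beyond the end of [e] evaluates to the default 0 and matches no index of the sum, so
    both sides agree there too. *)
Lemma zevalE (A : zmodType) (e : seq A) t :
  zeval e t = \sum_(i < size e) e`_i *~ zcoef i t.
Proof.
elim: t => /= [j||t -> u ->|t ->].
- have [lt_j|le_j] := ltnP j (size e).
    rewrite (bigD1 (Ordinal lt_j)) //= eqxx big1 ?addr0 // => i.
    by rewrite -val_eqE /= => /negPf->.
  rewrite nth_default // big1 // => i _.
  by rewrite ltn_eqF // (leq_trans (ltn_ord i)).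
- by rewrite big1.
- by rewrite -big_split; apply: eq_bigr => i _; rewrite mulrzDr.
- by rewrite -sumrN; apply: eq_bigr => i _; rewrite mulrNz.
Qed.

Definition zcheck (n : nat) t := all (fun i => zcoef i t == 0) (iota 0 n).

Lemma zcheckP (A : zmodType) (e : seq A) t u :
  zcheck (size e) (ZAdd t (ZOpp u)) -> zeval e t = zeval e u.
Proof.
move=> /allP chk; apply/eqP; rewrite -subr_eq0; apply/eqP.
change (zeval e (ZAdd t (ZOpp u)) = 0); rewrite zevalE big1 // => i _.
by rewrite (eqP (chk i _)) ?mulr0z // mem_iota ltn_ord.
Qed.

(** Reduces a goal modulo a known relation: what remains is a formal identity for [zmod], or is
    reduced again by another relation. *)
Lemma eq_modulo (A : zmodType) (a b c d : A) :
  a = b -> c - d = a - b -> c = d.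
Proof. by move=> -> /eqP; rewrite subrr subr_eq0 => /eqP. Qed.

End AbelianNormalization.

Ltac zindex x e :=
  lazymatch e with
  | x :: _ => constr:(0%N)
  | _ :: ?e' => let n := zindex x e' in constr:(S n)
  end.
Ltac zmem x e :=
  lazymatch e with
  | x :: _ => constr:(true)
  | _ :: ?e' => zmem x e'
  | _ => constr:(false)
  end.
(* The vector operations of an atom may come with different, convertible,
   canonical structures. *)
Ltac zmem_conv x e :=
  match e with
  | ?y :: _ => let _ := match goal with _ => unify x y end in constr:(y)
  | _ :: ?e' => zmem_conv x e'
  | _ => constr:(x)
  end.
Ltac zatoms t e :=
  lazymatch t with
  | (?a + ?b)%R => let e' := zatoms a e in zatoms b e'
  | (- ?a)%R => zatoms a e
  | 0%R => e
  | _ => let b := zmem t e in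
    lazymatch b with true => e | false => constr:(t :: e) end
  end.
Ltac zreify t e :=
  lazymatch t with
  | (?a + ?b)%R =>
    let a' := zreify a e in let b' := zreify b e in constr:(ZAdd a' b')
  | (- ?a)%R => let a' := zreify a e in constr:(ZOpp a')
  | 0%R => constr:(ZZero)
  | _ => let i := zindex t e in constr:(ZVar i)
  end.
Ltac zidentify e :=
  lazymatch e with
  | ?x :: ?e' =>
    let y := zmem_conv x e' in
    lazymatch x with y => idtac | _ => change x with y end; zidentify e'
  | _ => idtac
  end.
(* With variables for atoms, no conversion check can unfold them. *)
Ltac zgeneralize e :=
  lazymatch e with
  | ?x :: ?e' => generalize x; intro; zgeneralize e'
  | _ => idtac
  end.
Ltac zgoal_atoms k :=
  lazymatch goal with
  | |- @eq ?T ?l ?r =>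
    let e := zatoms l (@nil T) in let e := zatoms r e in k e
  end.
Ltac zsolve :=
  zgoal_atoms zgeneralize;
  lazymatch goal with
  | |- @eq ?T ?l ?r =>
    let e := zatoms l (@nil T) in let e := zatoms r e in
    let l' := zreify l e in let r' := zreify r e in
    refine (@zcheckP _ e l' r' _); vm_compute; reflexivity
  end.
Ltac zmod := first [zsolve | zgoal_atoms zidentify; zsolve].

Lemma linear_of (K : fieldType) (U V : lmodType K) (f : U -> V) :
  linear f -> {F : {linear U -> V} | F =1 f}.
Proof.
move=> lf; pose F := GRing.isLinear.Build K U V _ f lf.
pose G : {linear U -> V} := HB.pack f F.
by exists G.
Qed.

(** * Linear lifts through a linear map, in arbitrary dimension *)

Section LinearLift.
Variables (K : fieldType) (U V W : lmodType K).
Variables (p : {linear V -> W}) (f : {linear U -> W}).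
Hypothesis im_f : forall u, exists v, p v = f u.

(* Graphs of partial linear lifts of [f] through [p]; the empty graph is allowed. *)
Definition partial_lift (G : set (U * V)) :=
  [/\ forall (a : K) x y, G x -> G y -> G (a *: x + y),
      forall x, G x -> p x.2 = f x.1
    & forall v, G (0, v) -> v = 0].

(** Zorn's lemma applies because two points of the union of a chain both lie in the larger of two
    members; the empty chain has the empty graph as its union. *)
Lemma partial_lift_max :
  exists2 G, partial_lift G & forall B, proper G B -> ~ partial_lift B.
Proof.
have [|G [GP maxG]] := @Zorn_bigcup _ partial_lift; last by exists G.
move=> F FP totF; split.
- move=> a x y [X FX Xx] [Y FY Yy].
  have [sub|sub] := totF _ _ FX FY.
    by exists Y => //; have [GL _ _] := FP _ FY; apply: GL => //; apply: sub.
  by exists X => //; have [GL _ _] := FP _ FX; apply: GL => //; apply: sub.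
- by move=> x [X FX Xx]; have [_ H _] := FP _ FX; apply: H.
- by move=> v [X FX Xx]; have [_ _ H] := FP _ FX; apply: H.
Qed.

(** A maximal partial lift is total, since a vector [u] outside its domain could be adjoined with
    any preimage of [f u]. This serves to choose linearly the elements of [h] that induce given
    inner derivations. *)
Lemma linear_lift : exists b : {linear U -> V}, forall u, p (b u) = f u.
Proof.
have [G [GL Gp G0] maxG] := partial_lift_max.
have Gz : G 0.
  have [[x Gx]|noG] := pselect (exists x, G x).
    by have := GL (-1) x x Gx Gx; rewrite scaleN1r addNr.
  (* An empty [G] would be properly extended by the graph reduced to 0. *)
  case: (maxG (fun x => x = 0)); last by split=> [a _ _ -> ->|_ ->|v [->]]//;
    rewrite ?scaler0 ?addr0 ?linear0.
  by split=> [x Gx|sub]; case: noG; [exists x|exists 0; apply: sub].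
have Gtot u : exists v, G (u, v).
  apply: contrapT => noG; have [v pv] := im_f u.
  pose B : set (U * V) := fun x => exists c, exists2 y, G y & x = c *: (u, v) + y.
  apply: (maxG B).
    split=> [x Gx|sub]; first by exists 0, x; rewrite // scale0r add0r.
    by apply: noG; exists v; apply: sub; exists 1, 0; rewrite // scale1r addr0.
  split.
  - move=> a _ _ [c [y Gy ->]] [d [z Gz' ->]].
    exists (a * c + d), (a *: y + z); first exact: GL.
    by rewrite scalerDr scalerA scalerDl addrACA.
  - by move=> _ [c [y Gy ->]] /=; rewrite !linearP pv (Gp _ Gy).
  - move=> v' [c [y Gy E]].
    have [/= E1 E2] : (0 = c *: u + y.1 /\ v' = c *: v + y.2).
      by split; [apply: (congr1 fst E) | apply: (congr1 snd E)].
    have [c0|c0] := eqVneq c 0.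
      move: E1 E2; rewrite c0 !scale0r !add0r => E1 ->; apply: G0.
      by rewrite E1 -surjective_pairing.
    (* For nonzero [c], the relation [0 = c *: u + y.1] puts [u] in the domain of [G] with this
       value, contrary to the choice of [u]. *)
    case: noG; exists (- c^-1 *: y.2).
    have -> : (u, - c^-1 *: y.2) = - c^-1 *: y + 0.
      rewrite addr0 [y in RHS]surjective_pairing; congr pair.
      by rewrite -[y.1](addKr (c *: u)) -E1 addr0 scaleNr scalerN opprK
        scalerA mulVf // scale1r.
    exact: GL.
pose b u := sval (cid (Gtot u)).
have bG u : G (u, b u) := svalP (cid (Gtot u)).
(* The defect of linearity of [b] lies in [G] above 0, hence vanishes. *)
have lb : linear b.
  move=> a u v; apply/eqP; rewrite -subr_eq0; apply/eqP/G0.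
  have -> : (0, b (a *: u + v) - (a *: b u + b v)) =
      - 1 *: (a *: (u, b u) + (v, b v)) + (a *: u + v, b (a *: u + v)).
    by rewrite scaleN1r; congr pair; rewrite /= ?addNr // addrC.
  exact: GL (GL _ _ _ (bG u) (bG v)) (bG _).
have [F FE] := linear_of lb; exists F => u; rewrite FE.
exact: (Gp _ (bG u)).
Qed.

End LinearLift.

(** * Isomorphisms of extensions *)

Section Isomorphism.
Variables (K : fieldType).

Lemma lie2_hom_inv (E E' : lie2 K) (F : lie2_hom E E') :
    bijective (hom0 F) -> bijective (hom1 F) ->
  exists G : lie2_hom E' E, [/\ cancel (hom0 F) (hom0 G),
    cancel (hom0 G) (hom0 F), cancel (hom1 F) (hom1 G) &
    cancel (hom1 G) (hom1 F)].
Proof.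
move=> [f0 F0K f0K] [f1 F1K f1K].
have l0 : linear f0.
  by move=> a x y; apply: (can_inj F0K); rewrite linearP !f0K.
have l1 : linear f1.
  by move=> a x y; apply: (can_inj F1K); rewrite linearP !f1K.
have [G0 G0E] := linear_of l0; have [G1 G1E] := linear_of l1.
have hd a : diff E (G1 a) = G0 (diff E' a).
  by rewrite G0E G1E; apply: (can_inj F0K); rewrite -hom_diff f0K f1K.
have h0 x y : G0 (br0 x y) = br0 (G0 x) (G0 y).
  by rewrite !G0E; apply: (can_inj F0K); rewrite hom_br0 !f0K.
have h1 x a : G1 (br1 x a) = br1 (G0 x) (G1 a).
  by rewrite G0E !G1E; apply: (can_inj F1K); rewrite hom_br1 !f1K f0K.
by exists (Lie2Hom hd h0 h1); split=> x /=; rewrite ?G0E ?G1E.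
Qed.

Variables (g h : lie2 K).
Implicit Types E : extension g h.

Lemma ext_iso_refl E : ext_iso E E.
Proof.
by exists (@Lie2Hom K E E idfun idfun (fun _ => erefl) (fun _ _ => erefl)
  (fun _ _ => erefl)).
Qed.

Lemma ext_iso_trans E1 E2 E3 : ext_iso E1 E2 -> ext_iso E2 E3 -> ext_iso E1 E3.
Proof.
move=> [F [F0 F1 p0 p1]] [G [G0 G1 q0 q1]].
have hd a : diff E3 ((hom1 G \o hom1 F) a) = (hom0 G \o hom0 F) (diff E1 a).
  by rewrite /= !hom_diff.
have h0 x y : (hom0 G \o hom0 F) (br0 x y) =
    br0 ((hom0 G \o hom0 F) x) ((hom0 G \o hom0 F) y).
  by rewrite /= !hom_br0.
have h1 x a : (hom1 G \o hom1 F) (br1 x a) =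
    br1 ((hom0 G \o hom0 F) x) ((hom1 G \o hom1 F) a).
  by rewrite /= !hom_br1.
exists (Lie2Hom hd h0 h1); split=> x /=.
- by rewrite F0 G0.
- by rewrite F1 G1.
- by rewrite q0 p0.
- by rewrite q1 p1.
Qed.

(** The short five lemma, applied in each of the two degrees: homomorphisms of extensions are
    invertible, which makes isomorphism of extensions symmetric. *)
Lemma short_five (H T T' B : zmodType) (i : {additive H -> T})
    (i' : {additive H -> T'}) (p : {additive T -> B}) (p' : {additive T' -> B})
    (F : {additive T -> T'}) :
    injective i' -> (forall e, p e = 0 <-> exists u, i u = e) ->
    (forall e, p' e = 0 <-> exists u, i' u = e) -> (forall b, exists e, p e = b) ->
    (forall u, F (i u) = i' u) -> (forall e, p' (F e) = p e) ->
  bijective F.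
Proof.
move=> i'I pE p'E p_surj Fi pF.
have inj : injective F.
  move=> e e' Fee'; apply/eqP; rewrite -subr_eq0; apply/eqP.
  have /pE[u uE] : p (e - e') = 0 by rewrite -pF raddfB Fee' subrr raddf0.
  rewrite -uE; suff -> : u = 0 by rewrite raddf0.
  by apply: i'I; rewrite -Fi uE raddfB Fee' subrr raddf0.
have surj e' : exists e, F e = e'.
  have [e eE] := p_surj (p' e').
  have /p'E[u uE] : p' (e' - F e) = 0 by rewrite raddfB pF eE subrr.
  by exists (e + i u); rewrite raddfD Fi uE addrC subrK.
exists (fun e' => sval (cid (surj e'))) => e; last exact: svalP (cid (surj e)).
by apply: inj; exact: svalP (cid (surj (F e))).
Qed.

Lemma ext_iso_sym E E' : ext_iso E E' -> ext_iso E' E.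
Proof.
move=> [F [F0 F1 p0 p1]].
have [|| G [FG0 GF0 FG1 GF1]] := @lie2_hom_inv E E' F.
- exact: (short_five (@ext_inj0 _ _ _ E') (@ext_exact0 _ _ _ E)
    (@ext_exact0 _ _ _ E') (@ext_surj0 _ _ _ E) F0 p0).
- exact: (short_five (@ext_inj1 _ _ _ E') (@ext_exact1 _ _ _ E)
    (@ext_exact1 _ _ _ E') (@ext_surj1 _ _ _ E) F1 p1).
exists G; split=> e.
- by rewrite -F0 FG0.
- by rewrite -F1 FG1.
- by rewrite -p0 GF0.
- by rewrite -p1 GF1.
Qed.

(** Classes are predicates, so symmetry and transitivity turn an isomorphism into an equality of
    classes. *)
Lemma ext_iso_eq E E' : ext_iso E E' -> ext_iso E = ext_iso E'.
Proof.
move=> EE'; apply: funext => E''; apply: propext; split.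
  exact: ext_iso_trans (ext_iso_sym EE').
exact: ext_iso_trans EE'.
Qed.

End Isomorphism.

(** * Factor sets *)

Section BracketTheory.
Variables (K : fieldType) (l : lie2 K).

Definition br0E := (bilinDl (br0_bilin l), bilinDr (br0_bilin l),
  bilinNl (br0_bilin l), bilinNr (br0_bilin l), bilin0l (br0_bilin l),
  bilin0r (br0_bilin l)).
Definition br1E := (bilinDl (br1_bilin l), bilinDr (br1_bilin l),
  bilinNl (br1_bilin l), bilinNr (br1_bilin l), bilin0l (br1_bilin l),
  bilin0r (br1_bilin l)).

Lemma br1_jac (x y : deg0 l) (a : deg1 l) :
  br1 (br0 x y) a = br1 x (br1 y a) - br1 y (br1 x a).
Proof.
apply: eq_modulo (br1_jacobi x y a) _.
by rewrite /flip !br1E; zmod.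
Qed.
End BracketTheory.

Section FactorSets.
Variables (K : fieldType) (g h : lie2 K).
Variables (m0 : deg0 g -> deg0 h -> deg0 h) (m1 : deg0 g -> deg1 h -> deg1 h).
Variable m : deg1 g -> deg0 h -> deg1 h.

(** Linear maps from [g] to the strict derivations of [h], unbundled. How far they are from a
    homomorphism is recorded separately by [curvature]. *)
Record derivation_action : Prop := DerivationAction {
  m0_bilin : bilin m0;
  m1_bilin : bilin m1;
  m_bilin : bilin m;
  m_diff : forall x n, m0 x (diff h n) = diff h (m1 x n);
  m0_br0 : forall x u v, m0 x (br0 u v) = br0 (m0 x u) v + br0 u (m0 x v);
  m1_br1 : forall x u n, m1 x (br1 u n) = br1 (m0 x u) n + br1 u (m1 x n);
  m_br0 : forall a u v, m a (br0 u v) = br1 u (m a v) - br1 v (m a u)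
}.
Hypothesis hm : derivation_action.

(** The extensibility equations, with terms moved across so as to avoid [flip]; the last four field
    names refer to the Lie 2-algebra axiom that each one encodes. For a fixed action the conditions
    are linear in [(phi, omega, nu)]. *)
Record twisted_cocycle (phi : deg1 g -> deg0 h)
    (omega : deg0 g -> deg0 g -> deg0 h) (nu : deg0 g -> deg1 g -> deg1 h) :
    Prop := TwistedCocycle {
  tw_phi : linear phi;
  tw_omega : bilin omega;
  tw_alt : forall x, omega x x = 0;
  tw_nu : bilin nu;
  tw_br1_diff : forall a b,
    nu (diff g a) b + nu (diff g b) a = m b (phi a) + m a (phi b);
  tw_diff_br1 : forall x a,
    phi (br1 x a) + diff h (nu x a) = omega x (diff g a) + m0 x (phi a);
  tw_jacobi0 : forall x y z,
    m0 x (omega y z) + m0 y (omega z x) + m0 z (omega x y) =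
    omega (br0 x y) z + omega (br0 y z) x + omega (br0 z x) y;
  tw_jacobi1 : forall x y a,
    nu (br0 x y) a + nu y (br1 x a) + m1 y (nu x a) =
    nu x (br1 y a) + m1 x (nu y a) + m a (omega x y)
}.

(* The failure of [(m0, m1, m)] to be a strict homomorphism is inner. *)
Record curvature (phi : deg1 g -> deg0 h)
    (omega : deg0 g -> deg0 g -> deg0 h) (nu : deg0 g -> deg1 g -> deg1 h) :
    Prop := Curvature {
  cv_phi0 : forall a v,
    diff h (m a v) - m0 (diff g a) v = br0 (phi a) v;
  cv_phi1 : forall a n,
    m a (diff h n) - m1 (diff g a) n = br1 (phi a) n;
  cv_omega0 : forall x y v,
    m0 x (m0 y v) - m0 y (m0 x v) - m0 (br0 x y) v = br0 (omega x y) v;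
  cv_omega1 : forall x y n,
    m1 x (m1 y n) - m1 y (m1 x n) - m1 (br0 x y) n = br1 (omega x y) n;
  cv_nu : forall x a v,
    m (br1 x a) v - m1 x (m a v) + m a (m0 x v) = br1 v (nu x a)
}.

Definition factor_set phi omega nu :=
  twisted_cocycle phi omega nu /\ curvature phi omega nu.

Definition actE := (bilinDr (m0_bilin hm), bilinNr (m0_bilin hm),
  bilinDr (m1_bilin hm), bilinNr (m1_bilin hm), bilinDr (m_bilin hm),
  bilinNr (m_bilin hm)).

Section TwistedSums.
Variables (phi phi' : deg1 g -> deg0 h) (omega omega' : deg0 g -> deg0 g -> deg0 h).
Variables (nu nu' : deg0 g -> deg1 g -> deg1 h).
Hypothesis tw : twisted_cocycle phi omega nu.
Hypothesis tw' : twisted_cocycle phi' omega' nu'.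

(** Sums and opposites of twisted cocycles serve to translate a factor set by a cocycle and to take
    the difference of two factor sets. *)
Lemma twisted_cocycleD :
  twisted_cocycle (fun a => phi a + phi' a) (fun x y => omega x y + omega' x y)
    (fun x a => nu x a + nu' x a).
Proof.
split.
- by move=> k a b; rewrite (tw_phi tw) (tw_phi tw') scalerDr; zmod.
- split=> [x|y] k u v.
    by rewrite (tw_omega tw).1 (tw_omega tw').1 scalerDr; zmod.
  have /= -> := (tw_omega tw).2 y k u v; have /= -> := (tw_omega tw').2 y k u v.
  by rewrite scalerDr; zmod.
- by move=> x; rewrite (tw_alt tw) (tw_alt tw') addr0.
- split=> [x|y] k u v.
    by rewrite (tw_nu tw).1 (tw_nu tw').1 scalerDr; zmod.
  have /= -> := (tw_nu tw).2 y k u v; have /= -> := (tw_nu tw').2 y k u v.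
  by rewrite scalerDr; zmod.
- move=> a b; rewrite !actE; apply: eq_modulo (tw_br1_diff tw a b) _.
  by apply: eq_modulo (tw_br1_diff tw' a b) _; zmod.
- move=> x a; rewrite !actE linearD; apply: eq_modulo (tw_diff_br1 tw x a) _.
  by apply: eq_modulo (tw_diff_br1 tw' x a) _; zmod.
- move=> x y z; rewrite !actE; apply: eq_modulo (tw_jacobi0 tw x y z) _.
  by apply: eq_modulo (tw_jacobi0 tw' x y z) _; zmod.
move=> x y a; rewrite !actE; apply: eq_modulo (tw_jacobi1 tw x y a) _.
by apply: eq_modulo (tw_jacobi1 tw' x y a) _; zmod.
Qed.

Lemma twisted_cocycleN :
  twisted_cocycle (fun a => - phi a) (fun x y => - omega x y)
    (fun x a => - nu x a).
Proof.
split.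
- by move=> k a b; rewrite (tw_phi tw) scalerN; zmod.
- split=> [x|y] k u v; first by rewrite (tw_omega tw).1 scalerN; zmod.
  by have /= -> := (tw_omega tw).2 y k u v; rewrite scalerN; zmod.
- by move=> x; rewrite (tw_alt tw) oppr0.
- split=> [x|y] k u v; first by rewrite (tw_nu tw).1 scalerN; zmod.
  by have /= -> := (tw_nu tw).2 y k u v; rewrite scalerN; zmod.
- by move=> a b; rewrite !actE; apply: eq_modulo (esym (tw_br1_diff tw a b)) _; zmod.
- move=> x a; rewrite !actE linearN.
  by apply: eq_modulo (esym (tw_diff_br1 tw x a)) _; zmod.
- move=> x y z; rewrite !actE.
  by apply: eq_modulo (esym (tw_jacobi0 tw x y z)) _; zmod.
move=> x y a; rewrite !actE.
by apply: eq_modulo (esym (tw_jacobi1 tw x y a)) _; zmod.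
Qed.
End TwistedSums.

(** * The extension defined by a factor set *)

Section Extension.
Variables (phi : deg1 g -> deg0 h) (omega : deg0 g -> deg0 g -> deg0 h).
Variables (nu : deg0 g -> deg1 g -> deg1 h).
Hypothesis fs : factor_set phi omega nu.

Let tw := fs.1.
Let cv := fs.2.

(** The pair [(x, u)] plays the role of [t x + u] for a section [t]. The three structure maps expand
    those of such sums, [phi], [omega] and [nu] measuring how far [t] is from a homomorphism; the
    minus signs come from skew-symmetry, as in [[u, t a] = - [t a, u]]. *)
Definition fs_diff (e : deg1 g * deg1 h) : deg0 g * deg0 h :=
  (diff g e.1, diff h e.2 + phi e.1).
Definition fs_br0 (x y : deg0 g * deg0 h) : deg0 g * deg0 h :=
  (br0 x.1 y.1, br0 x.2 y.2 + m0 x.1 y.2 - m0 y.1 x.2 + omega x.1 y.1).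
Definition fs_br1 (x : deg0 g * deg0 h) (a : deg1 g * deg1 h) :
    deg1 g * deg1 h :=
  (br1 x.1 a.1, br1 x.2 a.2 + m1 x.1 a.2 - m a.1 x.2 + nu x.1 a.1).

Let pair_linE (U V : lmodType K) (k : K) (u u' : U) (v v' : V) :
  k *: (u, v) + (u', v') = (k *: u + u', k *: v + v').
Proof. by []. Qed.
Let pairDE (U V : lmodType K) (u u' : U) (v v' : V) :
  (u, v) + (u', v') = (u + u', v + v').
Proof. by []. Qed.
Let pairNE (U V : lmodType K) (u : U) (v : V) : - (u, v) = (- u, - v).
Proof. by []. Qed.

Fact fs_diff_linear : linear fs_diff.
Proof.
move=> k [e1 e2] [f1 f2]; rewrite /fs_diff !pair_linE /=.
rewrite !linearP (tw_phi tw) scalerDr; congr pair; zmod.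
Qed.
HB.instance Definition _ := GRing.isLinear.Build _ _ _ _ fs_diff fs_diff_linear.

Fact fs_br0_bilin : bilin fs_br0.
Proof.
split=> [[x1 x2]|[y1 y2]] k [u1 u2] [v1 v2]; rewrite /fs_br0 !pair_linE /=;
  congr pair.
- exact: (br0_bilin g).1.
- have /= -> := (m0_bilin hm).2 x2 k u1 v1.
  rewrite (br0_bilin h).1 (m0_bilin hm).1 (tw_omega tw).1 !scalerDr !scalerN; zmod.
- exact: ((br0_bilin g).2 y1).
have /= -> := (br0_bilin h).2 y2 k u2 v2.
have /= -> := (tw_omega tw).2 y1 k u1 v1.
have /= -> := (m0_bilin hm).2 y2 k u1 v1.
by rewrite (m0_bilin hm).1 !scalerDr !scalerN; zmod.
Qed.

Fact fs_br1_bilin : bilin fs_br1.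
Proof.
split=> [[x1 x2]|[y1 y2]] k [u1 u2] [v1 v2]; rewrite /fs_br1 !pair_linE /=;
  congr pair.
- exact: (br1_bilin g).1.
- have /= -> := (m_bilin hm).2 x2 k u1 v1.
  rewrite (br1_bilin h).1 (m1_bilin hm).1 (tw_nu tw).1 !scalerDr !scalerN; zmod.
- exact: ((br1_bilin g).2 y1).
have /= -> := (br1_bilin h).2 y2 k u2 v2.
have /= -> := (tw_nu tw).2 y1 k u1 v1.
have /= -> := (m1_bilin hm).2 y2 k u1 v1.
by rewrite (m_bilin hm).1 !scalerDr !scalerN; zmod.
Qed.

Fact fs_br0_alt (x : deg0 g * deg0 h) : fs_br0 x x = 0.
Proof.
case: x => [x1 x2]; rewrite /fs_br0 /= !br0_alt (tw_alt tw).
by rewrite add0r subrr addr0.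
Qed.

(** As for the next axioms, expansion separates the contributions: arguments all in [g] give a
    twisted cocycle equation, all in [h] an axiom of [h], and mixed ones a derivation property or a
    curvature equation. *)
Fact fs_diff_br1 x a : fs_diff (fs_br1 x a) = fs_br0 x (fs_diff a).
Proof.
case: x a => [x1 x2] [a1 a2]; rewrite /fs_diff /fs_br0 /=.
congr pair; first exact: diff_br1.
apply: eq_modulo (tw_diff_br1 tw x1 a1) _.
rewrite !(linearD (diff h)) (linearN (diff h)) !actE diff_br1 (m_diff hm).
rewrite !br0E (br0_skew x2 (phi _)) -(cv_phi0 cv); zmod.
Qed.

Fact fs_br1_diff a b : fs_br1 (fs_diff a) b = flip fs_br1 a (fs_diff b).
Proof.
case: a b => [a1 a2] [b1 b2]; rewrite /flip /fs_br1 /= pairNE.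
congr pair; first exact: br1_diff.
apply: eq_modulo (tw_br1_diff tw a1 b1) _.
have E : br1 (diff h a2) b2 = - br1 (diff h b2) a2 by exact: br1_diff.
rewrite !actE !br1E -!(cv_phi1 cv) E; zmod.
Qed.

Fact fs_br0_jacobi x y z :
  fs_br0 (fs_br0 x y) z + fs_br0 (fs_br0 y z) x + fs_br0 (fs_br0 z x) y = 0.
Proof.
case: x y z => [x1 x2] [y1 y2] [z1 z2]; rewrite /fs_br0 /= !pairDE.
congr pair; first exact: br0_jacobi.
apply: eq_modulo (br0_jacobi x2 y2 z2) _.
apply: eq_modulo (esym (tw_jacobi0 tw x1 y1 z1)) _.
rewrite !actE !br0E !(m0_br0 hm) -!(cv_omega0 cv).
rewrite !(br0_skew _ (m0 _ _)); zmod.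
Qed.

Fact fs_br1_jacobi x y a :
  fs_br1 (fs_br0 x y) a + flip fs_br1 (fs_br1 y a) x +
    flip fs_br1 (flip fs_br1 a x) y = 0.
Proof.
case: x y a => [x1 x2] [y1 y2] [a1 a2].
rewrite /flip /fs_br1 /fs_br0 /= !pairNE !pairDE /=.
congr pair; first exact: br1_jacobi.
apply: eq_modulo (br1_jacobi x2 y2 a2) _; rewrite /flip.
have EM : m (- br1 x1 a1) y2 = - m (br1 x1 a1) y2.
  exact: bilinNl (m_bilin hm) _ _.
have EN : nu y1 (- br1 x1 a1) = - nu y1 (br1 x1 a1).
  exact: bilinNr (tw_nu tw) _ _.
rewrite EM EN !actE !br1E !(m1_br1 hm) !(m_br0 hm).
rewrite -!(cv_omega1 cv) -!(cv_nu cv).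
apply: eq_modulo (tw_jacobi1 tw x1 y1 a1) _.
zmod.
Qed.

Definition fs_lie2 : lie2 K := @Lie2 K (Complex2 fs_diff) fs_br0 fs_br1
  fs_br0_bilin fs_br1_bilin fs_br0_alt fs_diff_br1 fs_br1_diff
  fs_br0_jacobi fs_br1_jacobi.

Definition fs_inc0 (u : deg0 h) : deg0 fs_lie2 := (0, u).
Definition fs_inc1 (n : deg1 h) : deg1 fs_lie2 := (0, n).
Definition fs_prj0 (e : deg0 fs_lie2) : deg0 g := e.1.
Definition fs_prj1 (e : deg1 fs_lie2) : deg1 g := e.1.

Fact fs_inc0_linear : linear fs_inc0.
Proof.
move=> k u v.
change ((0, k *: u + v) = (k *: 0 + 0, k *: u + v) :> deg0 g * deg0 h).
by rewrite scaler0 addr0.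
Qed.
Fact fs_inc1_linear : linear fs_inc1.
Proof.
move=> k u v.
change ((0, k *: u + v) = (k *: 0 + 0, k *: u + v) :> deg1 g * deg1 h).
by rewrite scaler0 addr0.
Qed.
Fact fs_prj0_linear : linear fs_prj0.
Proof. by []. Qed.
Fact fs_prj1_linear : linear fs_prj1.
Proof. by []. Qed.
HB.instance Definition _ := GRing.isLinear.Build _ _ _ _ fs_inc0 fs_inc0_linear.
HB.instance Definition _ := GRing.isLinear.Build _ _ _ _ fs_inc1 fs_inc1_linear.
HB.instance Definition _ := GRing.isLinear.Build _ _ _ _ fs_prj0 fs_prj0_linear.
HB.instance Definition _ := GRing.isLinear.Build _ _ _ _ fs_prj1 fs_prj1_linear.

Let phi0 : phi 0 = 0.
Proof. by have := tw_phi tw (-1) 0 0; rewrite scaler0 addr0 scaleN1r addNr. Qed.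

Fact fs_inc_diff n : diff fs_lie2 (fs_inc1 n) = fs_inc0 (diff h n).
Proof.
by rewrite /fs_inc0 /= /fs_diff /= linear0 phi0 addr0.
Qed.
Fact fs_inc_br0 u v : fs_inc0 (br0 u v) = br0 (fs_inc0 u) (fs_inc0 v).
Proof.
rewrite /fs_inc0 /= /fs_br0 /= !br0E (bilin0l (m0_bilin hm)).
by rewrite (bilin0l (m0_bilin hm)) (bilin0l (tw_omega tw)) !addr0 subr0.
Qed.
Fact fs_inc_br1 u n : fs_inc1 (br1 u n) = br1 (fs_inc0 u) (fs_inc1 n).
Proof.
rewrite /fs_inc1 /= /fs_br1 /= !br1E (bilin0l (m1_bilin hm)).
by rewrite (bilin0l (m_bilin hm)) (bilin0l (tw_nu tw)) !addr0 subr0.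
Qed.
Definition fs_inc : lie2_hom h fs_lie2 :=
  @Lie2Hom K h fs_lie2 fs_inc0 fs_inc1 fs_inc_diff fs_inc_br0 fs_inc_br1.
Definition fs_prj : lie2_hom fs_lie2 g :=
  @Lie2Hom K fs_lie2 g fs_prj0 fs_prj1 (fun=> erefl) (fun _ _ => erefl)
    (fun _ _ => erefl).

Fact fs_inj0 : injective fs_inc0. Proof. by move=> u v []. Qed.
Fact fs_inj1 : injective fs_inc1. Proof. by move=> u v []. Qed.
Fact fs_exact0 e : fs_prj0 e = 0 <-> exists u, fs_inc0 u = e.
Proof.
case: e => x u; split=> [x0|[v [<-]] //]; exists u.
by have {x0}-> : x = 0 by [].
Qed.
Fact fs_exact1 e : fs_prj1 e = 0 <-> exists n, fs_inc1 n = e.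
Proof.
case: e => x u; split=> [x0|[v [<-]] //]; exists u.
by have {x0}-> : x = 0 by [].
Qed.
Fact fs_surj0 x : exists e, fs_prj0 e = x. Proof. by exists (x, 0). Qed.
Fact fs_surj1 x : exists e, fs_prj1 e = x. Proof. by exists (x, 0). Qed.

Definition fs_ext : extension g h := @Extension K g h fs_lie2 fs_inc fs_prj
  fs_inj0 fs_inj1 fs_exact0 fs_exact1 fs_surj0 fs_surj1.
End Extension.

(** * Sections of an extension and their defect *)

Section Sections.
Variable E : extension g h.
Variables (t0 : {linear deg0 g -> deg0 E}) (t1 : {linear deg1 g -> deg1 E}).
Local Notation i0 := (hom0 (ext_inc E)).
Local Notation i1 := (hom1 (ext_inc E)).

(** Sections that act on [h] exactly by the given derivations, not merely up to inner ones. *)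
Record adapted : Prop := Adapted {
  ad_sec0 : cancel t0 (hom0 (ext_prj E));
  ad_sec1 : cancel t1 (hom1 (ext_prj E));
  ad_m0 : forall x v, i0 (m0 x v) = br0 (t0 x) (i0 v);
  ad_m1 : forall x n, i1 (m1 x n) = br1 (t0 x) (i1 n);
  ad_m : forall a v, i1 (m a v) = - br1 (i0 v) (t1 a)
}.

Record defect (phi : deg1 g -> deg0 h) (omega : deg0 g -> deg0 g -> deg0 h)
    (nu : deg0 g -> deg1 g -> deg1 h) : Prop := Defect {
  df_phi : forall a, i0 (phi a) = diff E (t1 a) - t0 (diff g a);
  df_omega : forall x y, i0 (omega x y) = br0 (t0 x) (t0 y) - t0 (br0 x y);
  df_nu : forall x a, i1 (nu x a) = br1 (t0 x) (t1 a) - t1 (br1 x a)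
}.

Hypothesis ad : adapted.

(** The projection is a homomorphism split by the sections, so it kills each failure. The preimages
    are chosen pointwise; their linearity follows later from injectivity of the inclusion. *)
Lemma defect_exists : exists phi omega nu, defect phi omega nu.
Proof.
have phiP a : exists u, i0 u = diff E (t1 a) - t0 (diff g a).
  apply/ext_exact0; rewrite raddfB /= -hom_diff (ad_sec0 ad) (ad_sec1 ad).
  by rewrite subrr.
have omegaP x y : exists u, i0 u = br0 (t0 x) (t0 y) - t0 (br0 x y).
  by apply/ext_exact0; rewrite raddfB /= hom_br0 !(ad_sec0 ad) subrr.
have nuP x a : exists u, i1 u = br1 (t0 x) (t1 a) - t1 (br1 x a).
  by apply/ext_exact1; rewrite raddfB /= hom_br1 (ad_sec0 ad) !(ad_sec1 ad) subrr.
exists (fun a => sval (cid (phiP a))), (fun x y => sval (cid (omegaP x y))),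
  (fun x a => sval (cid (nuP x a))).
split=> [a|x y|x a]; [exact: svalP (cid (phiP a))|
  exact: svalP (cid (omegaP x y))|exact: svalP (cid (nuP x a))].
Qed.

Section Defect.
Variables (phi : deg1 g -> deg0 h) (omega : deg0 g -> deg0 g -> deg0 h).
Variables (nu : deg0 g -> deg1 g -> deg1 h).
Hypothesis df : defect phi omega nu.

Let i0_inj := @ext_inj0 _ _ _ E.
Let i1_inj := @ext_inj1 _ _ _ E.

(** After applying the injective inclusion, every condition becomes a consequence of the axioms of
    [E] on values of the sections: with all arguments in [g] for the twisted equations, with one
    argument in [h] for the curvature. *)
Lemma defect_factor_set : factor_set phi omega nu.
Proof.
have dE n : i0 (diff h n) = diff E (i1 n) by rewrite hom_diff.
split; split.
- move=> k a b; apply: i0_inj; rewrite linearP !(df_phi df) !linearP /=.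
  by rewrite scalerDr !scalerN; zmod.
- split=> [x|y] k u v; apply: i0_inj; rewrite linearP !(df_omega df) linearP.
    by rewrite (br0_bilin E).1 (br0_bilin g).1 linearP scalerDr !scalerN; zmod.
  have /= -> := (br0_bilin E).2 (t0 y) k (t0 u) (t0 v).
  have /= -> := (br0_bilin g).2 y k u v.
  by rewrite linearP scalerDr !scalerN; zmod.
- move=> x; apply: i0_inj; rewrite (df_omega df) !br0_alt.
  by rewrite [t0 0]linear0 [i0 0]linear0 subrr.
- split=> [x|y] k u v; apply: i1_inj; rewrite linearP !(df_nu df) linearP.
    by rewrite (br1_bilin E).1 (br1_bilin g).1 linearP scalerDr !scalerN; zmod.
  have /= -> := (br1_bilin E).2 (t1 y) k (t0 u) (t0 v).
  have /= -> := (br1_bilin g).2 y k u v.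
  by rewrite linearP scalerDr !scalerN; zmod.
- move=> a b; apply: i1_inj; rewrite !raddfD /= !(ad_m ad) !(df_phi df) !(df_nu df).
  rewrite !br1E (br1_diff (t1 a)) (br1_diff a) /flip raddfN; zmod.
- move=> x a; apply: i0_inj; rewrite !raddfD /= dE (ad_m0 ad).
  rewrite !(df_phi df) (df_nu df) (df_omega df) raddfB /= !diff_br1 !br0E; zmod.
- move=> x y z; apply: i0_inj; rewrite !raddfD /= !(ad_m0 ad) !(df_omega df).
  rewrite !br0E !(br0_skew _ (br0 (t0 _) (t0 _))) !(br0_skew _ (t0 (br0 _ _))).
  (* The Jacobi identity enters twice: in [g], transported by [t0], and in [E], on the values of
     [t0]. *)
  have := congr1 t0 (br0_jacobi x y z); rewrite !raddfD raddf0 => J.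
  apply: eq_modulo J _; apply: eq_modulo (esym (br0_jacobi (t0 x) (t0 y) (t0 z))) _.
  zmod.
- move=> x y a; apply: i1_inj; rewrite !raddfD /= (ad_m ad) !(ad_m1 ad).
  rewrite !(df_nu df) (df_omega df) !br1E !br1_jac !raddfB /=; zmod.
- move=> a v; apply: i0_inj; rewrite raddfB /= dE (ad_m ad) (ad_m0 ad) hom_br0.
  by rewrite (df_phi df) !br0E raddfN /= diff_br1 (br0_skew (i0 v)); zmod.
- move=> a n; apply: i1_inj; rewrite raddfB /= (ad_m ad) (ad_m1 ad) hom_br1.
  by rewrite (df_phi df) dE !br1E [br1 (diff E (t1 _)) _]br1_diff.
- move=> x y v; apply: i0_inj; rewrite !raddfB /= !(ad_m0 ad) hom_br0 (df_omega df).
  rewrite !br0E; apply: eq_modulo (esym (br0_jacobi (t0 x) (t0 y) (i0 v))) _.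
  rewrite (br0_skew (br0 (t0 y) _)) (br0_skew (br0 (i0 v) _)).
  by rewrite (br0_skew (i0 v) (t0 x)) !br0E; zmod.
- move=> x y n; apply: i1_inj; rewrite !raddfB /= !(ad_m1 ad) hom_br1 (df_omega df).
  by rewrite !br1E br1_jac; zmod.
- move=> x a v; apply: i1_inj; rewrite raddfD raddfB /= !(ad_m ad) (ad_m1 ad).
  rewrite hom_br1 (ad_m ad) (ad_m0 ad) (df_nu df) !br1E br1_jac; zmod.
Qed.

(** The isomorphism sends [(x, u)] to [t x + i u]; it is a homomorphism by adaptedness and the
    definition of the defect. *)
Lemma defect_iso (fs : factor_set phi omega nu) : ext_iso (fs_ext fs) E.
Proof.
have dE n : i0 (diff h n) = diff E (i1 n) by rewrite hom_diff.
pose F0 (e : deg0 (fs_ext fs)) := t0 e.1 + i0 e.2.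
pose F1 (e : deg1 (fs_ext fs)) := t1 e.1 + i1 e.2.
have F0l : linear F0.
  by move=> k [x u] [y v]; rewrite /F0 /= !linearP scalerDr; zmod.
have F1l : linear F1.
  by move=> k [x u] [y v]; rewrite /F1 /= !linearP scalerDr; zmod.
have [G0 G0E] := linear_of F0l; have [G1 G1E] := linear_of F1l.
have hd a : diff E (G1 a) = G0 (diff (fs_ext fs) a).
  rewrite G0E G1E; case: a => a n; rewrite /F0 /F1 /= !raddfD /= dE (df_phi df).
  zmod.
have h0 x y : G0 (br0 x y) = br0 (G0 x) (G0 y).
  rewrite !G0E; case: x y => [x u] [y v]; rewrite /F0 /= !raddfD raddfN /=.
  rewrite hom_br0 !(ad_m0 ad) (df_omega df) !br0E (br0_skew (i0 u) (t0 y)).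
  zmod.
have h1 x a : G1 (br1 x a) = br1 (G0 x) (G1 a).
  rewrite G0E !G1E; case: x a => [x u] [a n]; rewrite /F0 /F1 /=.
  rewrite !raddfD raddfN /= hom_br1 (ad_m ad) (ad_m1 ad) (df_nu df) !br1E.
  zmod.
have pi0 u : hom0 (ext_prj E) (i0 u) = 0 by apply/ext_exact0; exists u.
have pi1 u : hom1 (ext_prj E) (i1 u) = 0 by apply/ext_exact1; exists u.
exists (Lie2Hom hd h0 h1); split=> e /=; rewrite ?G0E ?G1E /F0 /F1 /=.
- by rewrite linear0 add0r.
- by rewrite linear0 add0r.
- by rewrite raddfD /= (ad_sec0 ad) pi0 addr0.
by rewrite raddfD /= (ad_sec1 ad) pi1 addr0.
Qed.
End Defect.
End Sections.

End FactorSets.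

(** * Equivalence of factor sets *)

Section Equivalence.
Variables (K : fieldType) (g h : lie2 K).
Variables (m0 : deg0 g -> deg0 h -> deg0 h) (m1 : deg0 g -> deg1 h -> deg1 h).
Variable m : deg1 g -> deg0 h -> deg1 h.
Hypothesis hm : derivation_action m0 m1 m.

Variables (phi phi' : deg1 g -> deg0 h) (omega omega' : deg0 g -> deg0 g -> deg0 h).
Variables (nu nu' : deg0 g -> deg1 g -> deg1 h).
Variables (fs : factor_set m0 m1 m phi omega nu).
Variables (fs' : factor_set m0 m1 m phi' omega' nu').

(** These conditions say that [(x, u) |-> (x, b x + u)] is a homomorphism of the two extensions:
    centrality comes from brackets with elements of [h], the last three equations from elements of
    [g]. *)
Record equivalence_by (b0 : deg0 g -> deg0 h) (b1 : deg1 g -> deg1 h) : Prop :=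
  EquivalenceBy {
  eb_lin0 : linear b0;
  eb_lin1 : linear b1;
  eb_cen0 : forall x v, br0 (b0 x) v = 0;
  eb_cen01 : forall x n, br1 (b0 x) n = 0;
  eb_cen1 : forall v a, br1 v (b1 a) = 0;
  eb_phi : forall a, phi a - phi' a = diff h (b1 a) - b0 (diff g a);
  eb_omega : forall x y,
    omega x y - omega' x y = m0 x (b0 y) - m0 y (b0 x) - b0 (br0 x y);
  eb_nu : forall x a,
    nu x a - nu' x a = m1 x (b1 a) - m a (b0 x) - b1 (br1 x a)
}.

Lemma pair_add (U V : lmodType K) (x : U) (u v : V) :
  (x, u) + (0, v) = (x, u + v).
Proof.
change ((x + 0, u + v) = (x, u + v)).
by rewrite addr0.
Qed.

Lemma pair_sub (U V : lmodType K) (x y : U) (u v : V) :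
  (x, u) - (y, v) = (x - y, u - v).
Proof. by []. Qed.

(** In the second extension, the section [x |-> (x, b x)] is adapted because [b] is central, and its
    defect is the first factor set; [defect_iso] concludes. *)
Lemma equivalence_by_iso b0 b1 :
  equivalence_by b0 b1 -> ext_iso (fs_ext hm fs) (fs_ext hm fs').
Proof.
move=> [l0 l1 c0 c01 c1 ephi eomega enu].
have l0' : linear (fun x => (x, b0 x) : deg0 (fs_ext hm fs')).
  by move=> k x y; rewrite l0.
have l1' : linear (fun a => (a, b1 a) : deg1 (fs_ext hm fs')).
  by move=> k x y; rewrite l1.
have [t0 t0E] := linear_of l0'; have [t1 t1E] := linear_of l1'.
have N0 x : omega' x 0 = 0 by exact: bilin0r (tw_omega fs'.1) _.
have N1 x : nu' x 0 = 0 by exact: bilin0r (tw_nu fs'.1) _.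
have N2 y : nu' 0 y = 0 by exact: bilin0l (tw_nu fs'.1) _.
have Z0 v : m0 0 v = 0 by exact: bilin0l (m0_bilin hm) _.
have Z v : m 0 v = 0 by exact: bilin0l (m_bilin hm) _.
have Z1 v : m1 0 v = 0 by exact: bilin0l (m1_bilin hm) _.
apply: (@defect_iso _ _ _ _ _ _ hm (fs_ext hm fs') t0 t1).
- split=> [x|a|x v|x n|a v]; rewrite ?t0E ?t1E //=.
  + rewrite /fs_inc0 /fs_br0 /= br0E c0 Z0 N0 add0r subr0 addr0.
    by congr pair.
  + rewrite /fs_inc1 /fs_br1 /= br1E c01 Z N1 add0r subr0 addr0.
    by congr pair.
  rewrite /fs_inc1 /fs_inc0 /fs_br1 /= br1E c1 Z1 N2 !add0r addr0.
  change ((0, m a v) = (- 0, - - m a v) :> deg1 g * deg1 h).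
  by rewrite oppr0 opprK.
- split=> [a|x y|x a]; rewrite !t0E ?t1E /=.
  + rewrite /fs_inc0 /fs_diff /= [RHS]pair_sub subrr; congr pair.
    by apply: eq_modulo (ephi a) _; zmod.
  + rewrite /fs_inc0 /fs_br0 /= [RHS]pair_sub subrr; congr pair.
    by apply: eq_modulo (eomega x y) _; rewrite c0; zmod.
  rewrite /fs_inc1 /fs_br1 /= [RHS]pair_sub subrr; congr pair.
  by apply: eq_modulo (enu x a) _; rewrite c1; zmod.
Qed.

(** Compatibility with inclusions and projections forces the form [(x, u) |-> (x, b x + u)]; the
    conditions on [b] are then read off on pairs [(x, 0)] and [(0, v)]. *)
Lemma iso_equivalence_by :
  ext_iso (fs_ext hm fs) (fs_ext hm fs') -> exists b0 b1, equivalence_by b0 b1.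
Proof.
move=> [F [F0 F1 p0 p1]].
pose b0 (x : deg0 g) : deg0 h := (hom0 F (x, 0)).2.
pose b1 (a : deg1 g) : deg1 h := (hom1 F (a, 0)).2.
have F0E x u : hom0 F (x, u) = (x, b0 x + u).
  have -> : (x, u) = (x, 0) + (0, u) :> deg0 (fs_ext hm fs).
    by rewrite [RHS]pair_add add0r.
  rewrite linearD [X in _ + X]F0 -pair_add; congr (_ + _).
  by rewrite [LHS]surjective_pairing; congr pair; apply: p0.
have F1E x u : hom1 F (x, u) = (x, b1 x + u).
  have -> : (x, u) = (x, 0) + (0, u) :> deg1 (fs_ext hm fs).
    by rewrite [RHS]pair_add add0r.
  rewrite linearD [X in _ + X]F1 -pair_add; congr (_ + _).
  by rewrite [LHS]surjective_pairing; congr pair; apply: p1.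
exists b0, b1.
have o0 x : omega x 0 = 0 by exact: bilin0r (tw_omega fs.1) _.
have n0 x : nu x 0 = 0 by exact: bilin0r (tw_nu fs.1) _.
have n0' x : nu 0 x = 0 by exact: bilin0l (tw_nu fs.1) _.
have oo0 x : omega' x 0 = 0 by exact: bilin0r (tw_omega fs'.1) _.
have nn0 x : nu' x 0 = 0 by exact: bilin0r (tw_nu fs'.1) _.
have nn0' x : nu' 0 x = 0 by exact: bilin0l (tw_nu fs'.1) _.
have Z0 v : m0 0 v = 0 by exact: bilin0l (m0_bilin hm) _.
have Z v : m 0 v = 0 by exact: bilin0l (m_bilin hm) _.
have Z1 v : m1 0 v = 0 by exact: bilin0l (m1_bilin hm) _.
have Y0 v : m0 v 0 = 0 by exact: bilin0r (m0_bilin hm) _.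
have Y v : m v 0 = 0 by exact: bilin0r (m_bilin hm) _.
have Y1 v : m1 v 0 = 0 by exact: bilin0r (m1_bilin hm) _.
have l0 : linear b0.
  move=> k x y.
  have := F0E (k *: x + y) 0.
  have -> : (k *: x + y, 0) = k *: (x, 0) + (y, 0) :> deg0 (fs_ext hm fs).
    change ((k *: x + y, 0) = (k *: x + y, k *: 0 + 0) :> deg0 g * deg0 h).
    by rewrite scaler0 addr0.
  by rewrite linearP !F0E !addr0 => -[].
have l1 : linear b1.
  move=> k x y.
  have := F1E (k *: x + y) 0.
  have -> : (k *: x + y, 0) = k *: (x, 0) + (y, 0) :> deg1 (fs_ext hm fs).
    change ((k *: x + y, 0) = (k *: x + y, k *: 0 + 0) :> deg1 g * deg1 h).
    by rewrite scaler0 addr0.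
  by rewrite linearP !F1E !addr0 => -[].
have b00 : b0 0 = 0 by have := l0 (-1) 0 0; rewrite scaler0 addr0 scaleN1r addNr.
have b10 : b1 0 = 0 by have := l1 (-1) 0 0; rewrite scaler0 addr0 scaleN1r addNr.
have hb0 x u y v := hom_br0 F (x, u) (y, v).
have hb1 x u y v := hom_br1 F (x, u) (y, v).
have hd x u := hom_diff F (x, u).
(* Both extensions have the same action of [g] on [h], so these terms cancel in the bracket of
   [(x, 0)] with [(0, v)] and only the bracket with [b0 x] is left. *)
have c0 x v : br0 (b0 x) v = 0.
  have := hb0 x 0 0 v; rewrite !F0E /= /fs_br0 /=
    !(add0r, addr0) !br0E !Z0 o0 oo0 b00 ?br0E.
  rewrite !(add0r, addr0, subr0) => -[] H; apply: eq_modulo (esym H) _; zmod.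
have c01 x v : br1 (b0 x) v = 0.
  have := hb1 x 0 0 v; rewrite F0E !F1E /= /fs_br1 /=
    !(add0r, addr0) !br1E !Z nn0 n0 b10 ?br1E.
  rewrite !(add0r, addr0, subr0) => -[] H; apply: eq_modulo (esym H) _; zmod.
have c1 v a : br1 v (b1 a) = 0.
  have := hb1 0 v a 0; rewrite F0E !F1E b00 /= /fs_br1 /=
    !(add0r, addr0) !br1E !Z1 nn0' n0' b10 ?br1E.
  rewrite !(add0r, addr0, subr0) => -[] H; apply: eq_modulo (esym H) _; zmod.
split=> //.
- move=> a; have := hd a 0; rewrite F1E /= /fs_diff /= F0E linear0 add0r addr0.
  by move=> -[] H; apply: eq_modulo (esym H) _; zmod.
- move=> x y; have := hb0 x 0 y 0; rewrite !F0E /= /fs_br0 /= !addr0.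
  by rewrite c0 br0E !Y0 => -[] H; apply: eq_modulo H _; zmod.
move=> x a; have := hb1 x 0 a 0; rewrite F0E !F1E /= /fs_br1 /= !addr0.
by rewrite c1 br1E Y Y1 => -[] H; apply: eq_modulo H _; zmod.
Qed.

End Equivalence.

(** * Cochains of low degree *)

Section LowDegreeCochains.
Variables (K : fieldType) (g : lie2 K) (V : complex2 K).
Variable rho : lie2_hom g (Endo V).
Local Notation r0 x := (act0 (hom0 rho x)).
Local Notation r1 x := (act1 (hom0 rho x)).
Local Notation r a := (hom1 rho a).

Lemma size_del (T : Type) i (s : seq T) :
  (i < size s)%N -> (size (del i s)).+1 = size s.
Proof. by move=> lt_i; rewrite size_cat size_take size_drop lt_i; lia. Qed.

(** * Support of the coboundary *)

Section Vanishing.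
Variables (W : lmodType K) (F : Defs.form g W).
Variables (xs : seq (deg0 g)) (ys : seq (deg1 g)).

Lemma dhat_eq0 :
    (forall xs' ys', size xs' = (size xs).+1 -> (size ys').+1 = size ys ->
      F xs' ys' = 0) ->
  dhat F xs ys = 0.
Proof.
move=> F0; rewrite /dhat big1 ?scaler0 // => i _.
by rewrite F0 ?size_rcons ?size_del.
Qed.

Lemma d10_eq0 (R : deg0 g -> Defs.hom W W) :
    (forall xs' ys', (size xs').+1 = size xs -> size ys' = size ys ->
      F xs' ys' = 0) ->
  d10 (fun x => R x) F xs ys = 0.
Proof.
move=> F0; rewrite /d10 !big1 ?addr0 // => i _.
- by rewrite big1 // => j _; rewrite F0 ?scaler0 ?size_del // size_set_nth;
    have := ltn_ord j; lia.
- rewrite big1 // => j ij; rewrite F0 ?scaler0 //=.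
  have s1 := size_del (ltn_ord j); have s2 : (i < size (del j xs))%N.
    by have := ltn_ord j; lia.
  by rewrite size_del.
by rewrite F0 ?size_del // linear0 scaler0.
Qed.

End Vanishing.

Lemma dpartial_eq0 (F : Defs.form g (deg1 V)) xs ys :
  F xs ys = 0 -> dpartial F xs ys = 0.
Proof. by rewrite /dpartial => ->; rewrite linear0 scaler0. Qed.

Lemma d01_eq0 (F : Defs.form g (deg0 V)) xs ys :
    (forall ys', (size ys').+1 = size ys -> F xs ys' = 0) ->
  d01 rho F xs ys = 0.
Proof.
move=> F0; rewrite /d01 big1 ?scaler0 // => i _.
by rewrite F0 ?size_del // linear0.
Qed.

Lemma coboundary_fst (f : cochain g V) xs ys :
  (coboundary rho f).1 xs ys =
    dhat f.1 xs ys + dpartial f.2 xs ys + d10 (fun x => r0 x) f.1 xs ys.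
Proof. by []. Qed.

Lemma coboundary_snd (f : cochain g V) xs ys :
  (coboundary rho f).2 xs ys =
    dhat f.2 xs ys + d01 rho f.1 xs ys + d10 (fun x => r1 x) f.2 xs ys.
Proof. by []. Qed.

(** Each operator raises [p + 2q - s] by one. The excluded component [s = 1], [q = 0] receives
    nothing: its terms either run over no [g_1]-argument or come from the excluded component one
    degree lower. *)
Lemma coboundary_supported i (f : cochain g V) :
    supported i 0 f.1 -> supported i 1 f.2 ->
  supported i.+1 0 (coboundary rho f).1 /\ supported i.+1 1 (coboundary rho f).2.
Proof.
move=> s1 s2; split=> xs ys hs.
  rewrite coboundary_fst dhat_eq0 ?dpartial_eq0 ?d10_eq0 ?addr0 //.
  - by move=> xs' ys' sx sy; apply: s1; lia.
  - by apply: s2; lia.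
  by move=> xs' ys' sx sy; apply: s1; lia.
rewrite coboundary_snd dhat_eq0 ?d01_eq0 ?d10_eq0 ?addr0 //.
- by move=> xs' ys' sx sy; apply: s2; lia.
- by move=> ys' sy; apply: s1; lia.
by move=> xs' ys' sx sy; apply: s2; lia.
Qed.

Ltac expand_sums :=
  rewrite /dhat /dpartial /d01 /d10 /= ?big_ord_recl ?big_ord0;
  rewrite ?[\sum_(j < _ | (_ < j)%N) _]big_mkcond;
  rewrite /= ?big_ord_recl ?big_ord0 /= /bump /= ?add1n ?add0n /del /=;
  rewrite ?exprS ?expr0 ?mulr1 ?mulN1r ?opprK ?scaleN1r ?scale1r;
  rewrite ?scaler0 ?scaleN1r.

(* The suffix [pq] stands for the component on /\^p g_0 /\ (.)^q g_1. *)
Section Degree2.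
Variable f : cochain g V.
Hypothesis hf : is_cochain 2 f.

Lemma coboundary2_30 x y z :
  (coboundary rho f).1 [:: x; y; z] [::] =
    r0 x (f.1 [:: y; z] [::]) - r0 y (f.1 [:: x; z] [::]) +
    r0 z (f.1 [:: x; y] [::]) - f.1 [:: br0 x y; z] [::] +
    f.1 [:: br0 x z; y] [::] - f.1 [:: br0 y z; x] [::].
Proof.
have [_ _ s1 s2] := hf.
(* The value of [f.2] on three [g_0]-arguments alone has the right total degree, but is the
   component excluded by [p != i + 1]. *)
rewrite coboundary_fst dhat_eq0 // dpartial_eq0; last exact: s2.
by expand_sums; zmod.
Qed.

Lemma coboundary2_11 x a :
  (coboundary rho f).1 [:: x] [:: a] =
    f.1 [:: x; diff g a] [::] - diff V (f.2 [:: x] [:: a]) +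
    r0 x (f.1 [::] [:: a]) - f.1 [::] [:: br1 x a].
Proof.
by rewrite coboundary_fst; expand_sums; zmod.
Qed.

Lemma coboundary2_21 x y a :
  (coboundary rho f).2 [:: x; y] [:: a] =
    r a (f.1 [:: x; y] [::]) + r1 x (f.2 [:: y] [:: a]) -
    r1 y (f.2 [:: x] [:: a]) - f.2 [:: br0 x y] [:: a] -
    f.2 [:: y] [:: br1 x a] + f.2 [:: x] [:: br1 y a].
Proof.
have [_ _ s1 s2] := hf.
rewrite coboundary_snd dhat_eq0; last by move=> xs ys /= sx sy; apply: s2; lia.
by expand_sums; zmod.
Qed.

Lemma coboundary2_02 a b :
  (coboundary rho f).2 [::] [:: a; b] =
    r a (f.1 [::] [:: b]) + r b (f.1 [::] [:: a]) -
    f.2 [:: diff g a] [:: b] - f.2 [:: diff g b] [:: a].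
Proof.
by rewrite coboundary_snd; expand_sums; rewrite ?scalerDr ?scaleN1r; zmod.
Qed.
End Degree2.

Section Degree1.
Variable e : cochain g V.
Hypothesis he : is_cochain 1 e.

Lemma coboundary1_20 x y :
  (coboundary rho e).1 [:: x; y] [::] =
    r0 x (e.1 [:: y] [::]) - r0 y (e.1 [:: x] [::]) - e.1 [:: br0 x y] [::].
Proof.
have [_ _ s1 s2] := he.
rewrite coboundary_fst dhat_eq0 // dpartial_eq0; last exact: s2.
by expand_sums; zmod.
Qed.

Lemma coboundary1_01 a :
  (coboundary rho e).1 [::] [:: a] =
    diff V (e.2 [::] [:: a]) - e.1 [:: diff g a] [::].
Proof.
by rewrite coboundary_fst; expand_sums; zmod.
Qed.

Lemma coboundary1_11 x a :
  (coboundary rho e).2 [:: x] [:: a] =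
    r1 x (e.2 [::] [:: a]) - r a (e.1 [:: x] [::]) - e.2 [::] [:: br1 x a].
Proof.
have [_ _ s1 s2] := he.
rewrite coboundary_snd dhat_eq0; last by move=> xs ys /= sx sy; apply: s2; lia.
by expand_sums; zmod.
Qed.
End Degree1.

Section Table.
Variables (W : lmodType K) (c10 : deg0 g -> W) (c01 : deg1 g -> W).
Variables (c20 : deg0 g -> deg0 g -> W) (c11 : deg0 g -> deg1 g -> W).

(** The sizes [(1,0)], [(0,1)], [(2,0)], [(1,1)] are all those that support cochains of degree 1 or
    2, in either value degree. *)
Definition table : Defs.form g W := fun xs ys =>
  match xs, ys with
  | [:: x], [::] => c10 x
  | [::], [:: a] => c01 a
  | [:: x; y], [::] => c20 x y
  | [:: x], [:: a] => c11 x a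
  | _, _ => 0
  end.

Lemma table_is_form :
  linear c10 -> linear c01 -> bilin c20 -> (forall x, c20 x x = 0) -> bilin c11 ->
  is_form table.
Proof.
move=> l10 l01 [l20 l20'] alt20 [l11 l11'].
have l0 (U : lmodType K) : linear (fun _ : U => 0 : W).
  by move=> k u v; rewrite scaler0 addr0.
split.
- by move=> [|u [|v [|w l]]] [|t [|s q]] [|a [|b ys]] //=;
    first [exact: l0 | exact: l10 | exact: l20 | exact: l20' | exact: l11'].
- by move=> [|x [|y [|z xs]]] [|b [|c l]] [|d q] //=;
    first [exact: l0 | exact: l01 | exact: l11].
- by move=> [|u [|v [|w l]]] [|t [|s p]] q x [|a [|b ys]] //=; case: q.
move=> xs [|a [|b ys]] [|a' [|b' ys']] p //; have := perm_size p => //= _.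
  by have /perm_small_eq := p; move=> ->.
Qed.
End Table.

End LowDegreeCochains.

(** * Central factor sets and cohomology *)

Section Center.
Variables (K : fieldType) (h : lie2 K).

Lemma der_act0B (X Y : deg0 (SDer h)) u :
  der_act0 (X - Y) u = der_act0 X u - der_act0 Y u.
Proof. by rewrite addrC -scaleN1r der_act0_lin scaleN1r addrC. Qed.
Lemma der_act1B (X Y : deg0 (SDer h)) n :
  der_act1 (X - Y) n = der_act1 X n - der_act1 Y n.
Proof. by rewrite addrC -scaleN1r der_act1_lin scaleN1r addrC. Qed.
Lemma der_mapB (X Y : deg1 (SDer h)) u :
  der_map (X - Y) u = der_map X u - der_map Y u.
Proof. by rewrite addrC -scaleN1r der_map_lin scaleN1r addrC. Qed.

Lemma mem_cen0 (u : deg0 h) :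
  u \in Cen0 h <-> (forall v, br0 u v = 0) /\ (forall n, br1 u n = 0).
Proof.
split=> [/mem_mksub u0|[u0 u1]].
  split=> v.
    by have := congr1 (fun X => der_act0 X v) u0; rewrite /der_act0 act00.
  by have := congr1 (fun X => der_act1 X v) u0; rewrite /der_act1 act10.
apply/mem_mksub; apply: der0P => v.
  by rewrite /der_act0 act00; exact: u0.
by rewrite /der_act1 act10; exact: u1.
Qed.

Lemma mem_cen1 (n : deg1 h) : n \in Cen1 h <-> (forall v, br1 v n = 0).
Proof.
split=> [/mem_mksub n0 v|n0].
  apply/eqP; rewrite -oppr_eq0; apply/eqP.
  by have := congr1 (fun X => der_map X v) n0; rewrite /der_map hom0E.
apply/mem_mksub; apply: der1P => v; rewrite /der_map hom0E.
by change (- br1 v n = 0); rewrite n0 oppr0.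
Qed.
End Center.

Section Classification.
Variables (K : fieldType) (g h : lie2 K) (mubar : lie2_hom g (SOut h)).
Variables (s : pi_section h) (L : lifting_data mubar).

Definition lift_act0 (x : deg0 g) (v : deg0 h) : deg0 h :=
  der_act0 (mu0 mubar (lift_sec L) x) v.
Definition lift_act1 (x : deg0 g) (n : deg1 h) : deg1 h :=
  der_act1 (mu0 mubar (lift_sec L) x) n.
Definition lift_map (a : deg1 g) (v : deg0 h) : deg1 h :=
  der_map (mu1 mubar (lift_sec L) a) v.

Lemma lift_action : derivation_action lift_act0 lift_act1 lift_map.
Proof.
split.
- split=> [x|v] k u w; first exact: homfP.
  by rewrite /lift_act0 linearP der_act0_lin.
- split=> [x|v] k u w; first exact: homfP.
  by rewrite /lift_act1 linearP der_act1_lin.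
- split=> [x|v] k u w; first exact: homfP.
  by rewrite /lift_map linearP der_map_lin.
- by move=> x n; exact: der_act_diff.
- by move=> x u v; exact: der_act0_br0.
- by move=> x u n; exact: der_act1_br1.
by move=> a u v; rewrite /lift_map der_map_br0 /flip addrC.
Qed.

Lemma lift_curvature :
  curvature lift_act0 lift_act1 lift_map (phi L) (omega L) (nu L).
Proof.
split.
- by move=> a v; have := congr1 (fun X => der_act0 X v) (phiP L a);
    rewrite der_act0B.
- by move=> a n; have := congr1 (fun X => der_act1 X n) (phiP L a);
    rewrite der_act1B.
- by move=> x y v; have := congr1 (fun X => der_act0 X v) (omegaP L x y);
    rewrite der_act0B.
- by move=> x y n; have := congr1 (fun X => der_act1 X n) (omegaP L x y);
    rewrite der_act1B.
move=> x a v; have := congr1 (fun X => der_map X v) (nuP L a x).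
rewrite der_mapB /flip raddfN opprK.
(* Since [ad_1(n)(v) = [n, v] = - [v, n]], this sign cancels that of [nu(a, x) = - nu(x, a)]. *)
have -> : der_map (hom1 (ad h) (- nu L x a)) v = br1 v (nu L x a).
  change (- br1 v (- nu L x a) = br1 v (nu L x a)).
  by rewrite (bilinNr (br1_bilin h)) opprK.
move=> H.
have {}H : - (lift_act1 x (lift_map a v) - lift_map a (lift_act0 x v)) +
  lift_map (br1 x a) v = br1 v (nu L x a).
  exact: H.
by apply: eq_modulo H _; zmod.
Qed.

(** The representation is built from [s] and the factor sets from the section contained in [L]; on
    the center the two actions agree. *)
Lemma val_act0 x (u : deg0 (Cen h)) :
  val (act0 (hom0 (hatmu mubar s) x) u) = lift_act0 x (val u).
Proof. by rewrite (hatmu0_indep mubar s (lift_sec L)). Qed.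
Lemma val_act1 x (n : deg1 (Cen h)) :
  val (act1 (hom0 (hatmu mubar s) x) n) = lift_act1 x (val n).
Proof. by rewrite (hatmu0_indep mubar s (lift_sec L)). Qed.
Lemma val_map a (u : deg0 (Cen h)) :
  val (hom1 (hatmu mubar s) a u) = lift_map a (val u).
Proof. by rewrite (hatmu1_indep mubar s (lift_sec L)). Qed.

(** A 2-cochain is determined by three components, of sizes [(0,1)], [(2,0)] and [(1,1)]; they are
    viewed here with values in [h]. *)
Definition cphi (c : cochain g (Cen h)) (a : deg1 g) : deg0 h :=
  val (c.1 [::] [:: a]).
Definition comega (c : cochain g (Cen h)) (x y : deg0 g) : deg0 h :=
  val (c.1 [:: x; y] [::]).
Definition cnu (c : cochain g (Cen h)) (x : deg0 g) (a : deg1 g) : deg1 h :=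
  val (c.2 [:: x] [:: a]).

Let valD0 (u v : deg0 (Cen h)) : val (u + v) = val u + val v.
Proof. exact: raddfD. Qed.
Let valD1 (u v : deg1 (Cen h)) : val (u + v) = val u + val v.
Proof. exact: raddfD. Qed.
Let valN0 (u : deg0 (Cen h)) : val (- u) = - val u.
Proof. exact: raddfN. Qed.
Let valN1 (u : deg1 (Cen h)) : val (- u) = - val u.
Proof. exact: raddfN. Qed.
Let val0 : val (0 : deg0 (Cen h)) = 0. Proof. exact: raddf0. Qed.
Let val1 : val (0 : deg1 (Cen h)) = 0. Proof. exact: raddf0. Qed.
Let vald (n : deg1 (Cen h)) : val (diff (Cen h) n) = diff h (val n).
Proof. by []. Qed.
Let phiE c a : val (c.1 [::] [:: a]) = cphi c a. Proof. by []. Qed.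
Let omegaE c x y : val (c.1 [:: x; y] [::]) = comega c x y. Proof. by []. Qed.
Let nuE c x a : val (c.2 [:: x] [:: a]) = cnu c x a. Proof. by []. Qed.
Let valE := (phiE, omegaE, nuE, valD0, valD1, valN0, valN1,
  val0, val1, vald, val_act0, val_act1, val_map).

Section Cochain2.
Variable c : cochain g (Cen h).
Hypothesis c2 : is_cochain 2 c.

Lemma cochain_omega_bilin : bilin (comega c).
Proof.
have [[l1 l2 alt sym] _ _ _] := c2; split=> [x|y] k u v.
  by rewrite /comega (l1 [:: x] [::] [::]) val_lin.
by rewrite /comega (l1 [::] [:: y] [::]) val_lin.
Qed.

(** A 3-cochain has components [(0,2)], [(1,1)], [(3,0)] and [(2,1)]; for the coboundary of [c],
    their vanishing gives the four twisted equations, in this order. *)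
Lemma cocycle2P :
  coboundary (hatmu mubar s) c = 0 <->
  twisted_cocycle lift_act0 lift_act1 lift_map (cphi c) (comega c) (cnu c).
Proof.
have [[l1 l2 alt sym] [l1' l2' alt' sym'] s1 s2] := c2.
(* Skew-symmetry passes from the sums over [i < j] in the coboundary to the cyclic sums of the
   twisted equation. *)
have oN x y : comega c x y = - comega c y x.
  apply/eqP; rewrite -addr_eq0; apply/eqP.
  have oA u : comega c u u = 0.
    by rewrite /comega (alt [::] [::] [::]) val0.
  have := oA (x + y); rewrite (bilinDl cochain_omega_bilin).
  by rewrite !(bilinDr cochain_omega_bilin) !oA add0r addr0.
split=> [D0|tw].
  have D1 xs ys : (coboundary (hatmu mubar s) c).1 xs ys = 0 by rewrite D0.
  have D2 xs ys : (coboundary (hatmu mubar s) c).2 xs ys = 0 by rewrite D0.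
  split.
  - by move=> k a b; rewrite /cphi (l2 [::] [::] [::]) val_lin.
  - exact: cochain_omega_bilin.
  - by move=> x; rewrite /comega (alt [::] [::] [::]) val0.
  - split=> [x|y] k u v; first by rewrite /cnu (l2' [:: x] [::] [::]) val_lin.
    by rewrite /cnu (l1' [::] [::] [:: y]) val_lin.
  - move=> a b; have := congr1 val (D2 [::] [:: a; b]).
    rewrite coboundary2_02 !valE => H.
    by apply: eq_modulo (esym H) _; zmod.
  - move=> x a; have := congr1 val (D1 [:: x] [:: a]).
    rewrite coboundary2_11 !valE => H.
    by apply: eq_modulo (esym H) _; zmod.
  - move=> x y z; have := congr1 val (D1 [:: x; y; z] [::]).
    rewrite (coboundary2_30 _ c2) !valE => H; apply: eq_modulo H _.
    rewrite (oN z x) (oN (br0 z x)) (br0_skew z x) !(bilinNr cochain_omega_bilin).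
    rewrite (oN y (br0 x z)) (bilinNr (m0_bilin lift_action)); zmod.
  move=> x y a; have := congr1 val (D2 [:: x; y] [:: a]).
  rewrite (coboundary2_21 _ c2) !valE => H; apply: eq_modulo (esym H) _.
  by zmod.
have [sD1 sD2] := coboundary_supported (hatmu mubar s) s1 s2.
have D1 xs ys : (coboundary (hatmu mubar s) c).1 xs ys = 0.
  apply: val_inj; case: xs => [|x [|y [|z [|t xs]]]]; case: ys => [|a [|b ys]];
    try (by rewrite sD1 //=; lia).
    rewrite coboundary2_11 !valE.
    by apply: eq_modulo (esym (tw_diff_br1 tw x a)) _; zmod.
  rewrite (coboundary2_30 _ c2) !valE; apply: eq_modulo (tw_jacobi0 tw x y z) _.
  rewrite (oN z x) (oN (br0 z x)) (br0_skew z x) !(bilinNr cochain_omega_bilin).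
  rewrite (oN y (br0 x z)) (bilinNr (m0_bilin lift_action)); zmod.
have D2 xs ys : (coboundary (hatmu mubar s) c).2 xs ys = 0.
  apply: val_inj; case: xs => [|x [|y [|z xs]]]; case: ys => [|a [|b [|d ys]]];
    try (by rewrite sD2 //=; lia).
    rewrite coboundary2_02 !valE.
    by apply: eq_modulo (esym (tw_br1_diff tw a b)) _; zmod.
  rewrite (coboundary2_21 _ c2) !valE.
  by apply: eq_modulo (esym (tw_jacobi1 tw x y a)) _; zmod.
rewrite [LHS]surjective_pairing; congr pair; apply/funext => xs.
  by apply/funext => ys; exact: D1.
by apply/funext => ys; exact: D2.
Qed.
End Cochain2.

Lemma cochain2_exists (f : deg1 g -> deg0 h) (o : deg0 g -> deg0 g -> deg0 h)
    (n : deg0 g -> deg1 g -> deg1 h) :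
    linear f -> bilin o -> (forall x, o x x = 0) -> bilin n ->
    (forall a, f a \in Cen0 h) -> (forall x y, o x y \in Cen0 h) ->
    (forall x a, n x a \in Cen1 h) ->
  exists2 c : cochain g (Cen h), is_cochain 2 c &
    [/\ forall a, cphi c a = f a, forall x y, comega c x y = o x y &
       forall x a, cnu c x a = n x a].
Proof.
move=> lf [lo lo'] alto [ln ln'] fC oC nC.
pose f' a : deg0 (Cen h) := exist _ (f a) (fC a).
pose o' x y : deg0 (Cen h) := exist _ (o x y) (oC x y).
pose n' x a : deg1 (Cen h) := exist _ (n x a) (nC x a).
have l0 (U W : lmodType K) : linear (fun _ : U => 0 : W).
  by move=> k u v; rewrite scaler0 addr0.
exists (table (fun=> 0) f' o' (fun _ _ => 0),
        table (fun=> 0) (fun=> 0) (fun _ _ => 0) n') => //; split.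
- apply: table_is_form => //; try by split=> ?; exact: l0.
  + by move=> k a b; apply: val_inj; rewrite val_lin; exact: lf.
  + split=> [x|y] k u v; apply: val_inj; rewrite val_lin; first exact: lo.
    exact: lo'.
  + by move=> x; apply: val_inj; exact: alto.
- apply: table_is_form => //; try by split=> ?; exact: l0.
  split=> [x|y] k u v; apply: val_inj; rewrite val_lin; first exact: ln.
  exact: ln'.
- by move=> [|x [|y [|z xs]]] [|a [|b ys]].
by move=> [|x [|y [|z xs]]] [|a [|b ys]].
Qed.

Lemma cochain1_exists (b0 : deg0 g -> deg0 h) (b1 : deg1 g -> deg1 h) :
    linear b0 -> linear b1 ->
    (forall x, b0 x \in Cen0 h) -> (forall a, b1 a \in Cen1 h) ->
  exists2 e : cochain g (Cen h), is_cochain 1 e &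
    (forall x, val (e.1 [:: x] [::]) = b0 x) /\
    (forall a, val (e.2 [::] [:: a]) = b1 a).
Proof.
move=> l0 l1 b0C b1C.
pose b0' x : deg0 (Cen h) := exist _ (b0 x) (b0C x).
pose b1' a : deg1 (Cen h) := exist _ (b1 a) (b1C a).
have lz (U W : lmodType K) : linear (fun _ : U => 0 : W).
  by move=> k u v; rewrite scaler0 addr0.
exists (table b0' (fun=> 0) (fun _ _ => 0) (fun _ _ => 0),
        table (fun=> 0) b1' (fun _ _ => 0) (fun _ _ => 0)) => //; split.
- apply: table_is_form => //; try by split=> ?; exact: lz.
  by move=> k a b; apply: val_inj; rewrite val_lin; exact: l0.
- apply: table_is_form => //; try by split=> ?; exact: lz.
  by move=> k a b; apply: val_inj; rewrite val_lin; exact: l1.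
- by move=> [|x [|y [|z xs]]] [|a [|b ys]].
by move=> [|x [|y [|z xs]]] [|a [|b ys]].
Qed.

Local Notation Z2 := (cocycle (hatmu mubar s) 2).

Lemma cocycle_is_cochain (c : Z2) : is_cochain 2 (val c).
Proof. by have /mem_mksub[] := valP c. Qed.

Lemma cocycle_twisted (c : Z2) :
  twisted_cocycle lift_act0 lift_act1 lift_map
    (cphi (val c)) (comega (val c)) (cnu (val c)).
Proof. by have /mem_mksub[c2 /(cocycle2P c2)] := valP c. Qed.

Definition coboundary_by (c c' : cochain g (Cen h)) (b0 : deg0 g -> deg0 h)
    (b1 : deg1 g -> deg1 h) :=
  [/\ forall a, cphi c a - cphi c' a = diff h (b1 a) - b0 (diff g a),
      forall x y, comega c x y - comega c' x y =
        lift_act0 x (b0 y) - lift_act0 y (b0 x) - b0 (br0 x y)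
    & forall x a, cnu c x a - cnu c' x a =
        lift_act1 x (b1 a) - lift_map a (b0 x) - b1 (br1 x a)].

(** A 1-cochain amounts to linear maps [g_0 -> Cen^0] and [g_1 -> Cen^1], its components of sizes
    [(1,0)] and [(0,1)]; its coboundary is compared with [c - c'] on the three components of a
    2-cochain. *)
Lemma cohomology_eqP (c c' : Z2) :
  proj c = proj c' :> cohomology (hatmu mubar s) 2 <->
  exists b0 b1, [/\ linear b0, linear b1, forall x, b0 x \in Cen0 h,
    forall a, b1 a \in Cen1 h & coboundary_by (val c) (val c') b0 b1].
Proof.
have [f1 f2 s1 s2] := cocycle_is_cochain c.
have [f1' f2' s1' s2'] := cocycle_is_cochain c'.
split=> [/projP/mem_mksub[e e1 Ee]|[b0 [b1 [l0 l1 b0C b1C [E0 E1 E2]]]]].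
  have {}Ee : val c - val c' = coboundary (hatmu mubar s) e.
    by rewrite -Ee [RHS]raddfB.
  have D1 xs ys : (val c).1 xs ys - (val c').1 xs ys =
    (coboundary (hatmu mubar s) e).1 xs ys by rewrite -Ee.
  have D2 xs ys : (val c).2 xs ys - (val c').2 xs ys =
    (coboundary (hatmu mubar s) e).2 xs ys by rewrite -Ee.
  have [[g1 _ _ _] [_ g2 _ _] t1 t2] := e1.
  exists (fun x => val (e.1 [:: x] [::])), (fun a => val (e.2 [::] [:: a])).
  split.
  - by move=> k x y; rewrite (g1 [::] [::] [::]) val_lin.
  - by move=> k x y; rewrite (g2 [::] [::] [::]) val_lin.
  - by move=> x; exact: valP.
  - by move=> a; exact: valP.
  split.
  - by move=> a; have := congr1 val (D1 [::] [:: a]);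
      rewrite coboundary1_01 !valE.
  - by move=> x y; have := congr1 val (D1 [:: x; y] [::]);
      rewrite (coboundary1_20 _ e1) !valE.
  by move=> x a; have := congr1 val (D2 [:: x] [:: a]);
    rewrite (coboundary1_11 _ e1) !valE.
have [e e1 [e0E e1E]] := cochain1_exists l0 l1 b0C b1C.
have [_ _ t1 t2] := e1.
have [sD1 sD2] := coboundary_supported (hatmu mubar s) t1 t2.
apply/projP/mem_mksub; exists e => //; rewrite [LHS]raddfB.
have D1 xs ys : (val c).1 xs ys - (val c').1 xs ys =
    (coboundary (hatmu mubar s) e).1 xs ys.
  apply: val_inj; case: xs => [|x [|y [|z xs]]]; case: ys => [|a [|b ys]];
    try (by rewrite sD1 ?s1 ?s1' ?subr0 //=; lia).
    by rewrite coboundary1_01 !valE e0E e1E.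
  by rewrite (coboundary1_20 _ e1) !valE !e0E.
have D2 xs ys : (val c).2 xs ys - (val c').2 xs ys =
    (coboundary (hatmu mubar s) e).2 xs ys.
  apply: val_inj; case: xs => [|x [|y [|z [|t xs]]]]; case: ys => [|a [|b ys]];
    try (by rewrite sD2 ?s2 ?s2' ?subr0 //=; lia).
  by rewrite (coboundary1_11 _ e1) !valE e0E !e1E.
rewrite [LHS]surjective_pairing [RHS]surjective_pairing; congr pair.
  by apply/funext => xs; apply/funext => ys; exact: D1.
by apply/funext => xs; apply/funext => ys; exact: D2.
Qed.
End Classification.

(** * Parametrization *)

Section Parametrization.
Variables (K : fieldType) (g h : lie2 K) (mubar : lie2_hom g (SOut h)).
Variables (s : pi_section h) (L : lifting_data mubar).
Local Notation m0 := (lift_act0 L).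
Local Notation m1 := (lift_act1 L).
Local Notation m := (lift_map L).
Local Notation mA := (lift_action L).
Hypothesis L_twisted : twisted_cocycle m0 m1 m (phi L) (omega L) (nu L).
Local Notation Z2 := (cocycle (hatmu mubar s) 2).

(** Translation by central values leaves the curvature equations unchanged, and the twisted
    equations are additive. *)
Lemma cocycle_factor_set (c : Z2) :
  factor_set m0 m1 m (fun a => phi L a + cphi (val c) a)
    (fun x y => omega L x y + comega (val c) x y)
    (fun x a => nu L x a + cnu (val c) x a).
Proof.
split; first exact: (twisted_cocycleD mA L_twisted (cocycle_twisted _ c)).
have [cv1 cv2 cv3 cv4 cv5] := lift_curvature L.
have C0 (u : deg0 (Cen h)) v : br0 (val u) v = 0.
  by have [] := (mem_cen0 _).1 (valP u).
have C01 (u : deg0 (Cen h)) v : br1 (val u) v = 0.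
  by have [] := (mem_cen0 _).1 (valP u).
have C1 (u : deg1 (Cen h)) v : br1 v (val u) = 0.
  exact: (mem_cen1 _).1 (valP u) v.
split.
- by move=> a v; rewrite br0E C0 addr0.
- by move=> a v; rewrite br1E C01 addr0.
- by move=> x y v; rewrite br0E C0 addr0.
- by move=> x y v; rewrite br1E C01 addr0.
by move=> x a v; rewrite br1E C1 addr0.
Qed.

Definition cocycle_ext (c : Z2) : extension g h :=
  fs_ext mA (cocycle_factor_set c).

(** The section [x |-> (x, 0)] acts on [h] exactly by the lifted derivations. *)
Lemma factor_set_induces phi' omega' nu'
    (fs : factor_set m0 m1 m phi' omega' nu') :
  induces mubar (fs_ext mA fs).
Proof.
have l0 : linear (fun x => (x, 0) : deg0 (fs_ext mA fs)).
  move=> k x y.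
  change ((k *: x + y, 0) = (k *: x + y, k *: 0 + 0) :> deg0 g * deg0 h).
  by rewrite scaler0 addr0.
have l1 : linear (fun a => (a, 0) : deg1 (fs_ext mA fs)).
  move=> k x y.
  change ((k *: x + y, 0) = (k *: x + y, k *: 0 + 0) :> deg1 g * deg1 h).
  by rewrite scaler0 addr0.
have [t0 t0E] := linear_of l0; have [t1 t1E] := linear_of l1.
exists t0, t1, (mu0 mubar (lift_sec L)), (mu1 mubar (lift_sec L)); split.
- by split=> x; rewrite ?t0E ?t1E.
- split=> [x v|x n|a v]; rewrite ?t0E ?t1E /=.
  + rewrite /fs_inc0 /fs_br0 /= (bilin0r (br0_bilin g)) (bilin0l (br0_bilin h)).
    by rewrite (bilin0l (m0_bilin mA)) (bilin0r (tw_omega fs.1)) add0r subr0 addr0.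
  + rewrite /fs_inc1 /fs_br1 /= (bilin0r (br1_bilin g)) (bilin0l (br1_bilin h)).
    by rewrite (bilin0l (m_bilin mA)) (bilin0r (tw_nu fs.1)) add0r subr0 addr0.
  rewrite /flip /= /fs_inc1 /fs_inc0 /fs_br1 /= (bilin0l (m1_bilin mA)).
  rewrite (bilin0l (tw_nu fs.1)) (bilin0l (br1_bilin g)) (bilin0r (br1_bilin h)).
  change ((0, m a v) = (- 0, - (0 + 0 - m a v + 0)) :> deg1 g * deg1 h).
  by rewrite oppr0 !add0r addr0 opprK.
- by move=> x; rewrite pi_mu0.
by move=> a; rewrite pi_mu1.
Qed.

(** The action of the given sections differs from the lifted one by inner derivations; adding to the
    sections elements of [h] inducing the difference makes them adapted. *)
Lemma induces_adapted (E : extension g h) :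
  induces mubar E -> exists t0 t1, adapted m0 m1 m (E := E) t0 t1.
Proof.
move=> [s0 [s1 [M0 [M1 [[s0K s1K] [r0 r1 r2] p0 p1]]]]].
(* In [induces] the actions are bare functions; they inherit linearity from the sections through the
   injective inclusion. *)
have l0 : linear M0.
  move=> k x y; apply: der0P => v.
    apply: (@ext_inj0 _ _ _ E); rewrite r0 der_act0_lin linearP.
    have /= -> := (br0_bilin E).2 (hom0 (ext_inc E) v) k (s0 x) (s0 y).
    by rewrite linearP /= !r0.
  apply: (@ext_inj1 _ _ _ E); rewrite r1 der_act1_lin linearP.
  have /= -> := (br1_bilin E).2 (hom1 (ext_inc E) v) k (s0 x) (s0 y).
  by rewrite linearP /= !r1.
have l1 : linear M1.
  move=> k a b; apply: der1P => v.
  apply: (@ext_inj1 _ _ _ E); rewrite r2 der_map_lin [RHS]linearP /= !r2.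
  by rewrite /flip [s1 _]linearP (br1_bilin E).1 scalerN; zmod.
have lf0 : linear (fun x => mu0 mubar (lift_sec L) x - M0 x).
  by move=> k x y; rewrite l0 linearP scalerBr; zmod.
have lf1 : linear (fun a => mu1 mubar (lift_sec L) a - M1 a).
  by move=> k x y; rewrite l1 linearP scalerBr; zmod.
have [f0 f0E] := linear_of lf0; have [f1 f1E] := linear_of lf1.
(* Pointwise choices of an element inducing an inner derivation are only determined up to the
   center; [linear_lift] makes them linear. *)
have [b0 b0E] : exists b : {linear deg0 g -> deg0 h},
    forall x, hom0 (ad h) (b x) = f0 x.
  apply: linear_lift => x; rewrite f0E.
  have /projP/mem_mksub[u uE] : hom0 (Defs.pi h) (mu0 mubar (lift_sec L) x) =
    hom0 (Defs.pi h) (M0 x) by rewrite pi_mu0 p0.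
  by exists u.
have [b1 b1E] : exists b : {linear deg1 g -> deg1 h},
    forall x, hom1 (ad h) (b x) = f1 x.
  apply: linear_lift => x; rewrite f1E.
  have /projP/mem_mksub[u uE] : hom1 (Defs.pi h) (mu1 mubar (lift_sec L) x) =
    hom1 (Defs.pi h) (M1 x) by rewrite pi_mu1 p1.
  by exists u.
have lt0 : linear (fun x => s0 x + hom0 (ext_inc E) (b0 x)).
  by move=> k x y; rewrite !linearP /= scalerDr; zmod.
have lt1 : linear (fun a => s1 a + hom1 (ext_inc E) (b1 a)).
  by move=> k x y; rewrite !linearP /= scalerDr; zmod.
have [t0 t0E] := linear_of lt0; have [t1 t1E] := linear_of lt1.
have pi0 u : hom0 (ext_prj E) (hom0 (ext_inc E) u) = 0.
  by apply/ext_exact0; exists u.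
have pi1 u : hom1 (ext_prj E) (hom1 (ext_inc E) u) = 0.
  by apply/ext_exact1; exists u.
have e0 x v : m0 x v = der_act0 (M0 x) v + br0 (b0 x) v.
  have := congr1 (fun X => der_act0 X v) (b0E x).
  rewrite f0E der_act0B => H.
  have {}H : br0 (b0 x) v = m0 x v - der_act0 (M0 x) v by exact: H.
  by rewrite H addrC subrK.
have e1 x v : m1 x v = der_act1 (M0 x) v + br1 (b0 x) v.
  have := congr1 (fun X => der_act1 X v) (b0E x).
  rewrite f0E der_act1B => H.
  have {}H : br1 (b0 x) v = m1 x v - der_act1 (M0 x) v by exact: H.
  by rewrite H addrC subrK.
have e2 a v : m a v = der_map (M1 a) v - br1 v (b1 a).
  have := congr1 (fun X => der_map X v) (b1E a).
  rewrite f1E der_mapB => H.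
  have {}H : - br1 v (b1 a) = m a v - der_map (M1 a) v by exact: H.
  by rewrite H addrC subrK.
exists t0, t1; split.
- by move=> x; rewrite t0E raddfD /= s0K pi0 addr0.
- by move=> x; rewrite t1E raddfD /= s1K pi1 addr0.
- by move=> x v; rewrite e0 t0E raddfD /= r0 hom_br0 br0E.
- by move=> x v; rewrite e1 t0E raddfD /= r1 hom_br1 br1E.
by move=> a v; rewrite e2 t1E raddfB /= r2 hom_br1 !br1E opprD.
Qed.

(** The base factor set cancels in the difference, so an equivalence of the two factor sets is the
    same as a coboundary relation between [c] and [c']. *)
Lemma cocycle_ext_iso (c c' : Z2) :
  ext_iso (cocycle_ext c) (cocycle_ext c') <->
  proj c = proj c' :> cohomology (hatmu mubar s) 2.
Proof.
have red (A : zmodType) (x y z : A) : x + y - (x + z) = y - z by zmod.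
split.
  move=> /iso_equivalence_by[b0 [b1 [l0 l1 c0 c01 c1 E0 E1 E2]]].
  apply/(cohomology_eqP L); exists b0, b1; split=> //.
  - by move=> x; apply/mem_cen0; split.
  - by move=> a; apply/mem_cen1.
  split=> [a|x y|x a]; [move: (E0 a)|move: (E1 x y)|move: (E2 x a)];
    by rewrite red.
move=> /(cohomology_eqP L)[b0 [b1 [l0 l1 b0C b1C [E0 E1 E2]]]].
apply: (@equivalence_by_iso _ _ _ _ _ _ _ _ _ _ _ _ _ _ _ b0 b1).
split=> //.
- by move=> x; have [] := (mem_cen0 _).1 (b0C x).
- by move=> x; have [] := (mem_cen0 _).1 (b0C x).
- by move=> v a; exact: (mem_cen1 _).1 (b1C a) v.
- by move=> a; rewrite red E0.
- by move=> x y; rewrite red E1.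
by move=> x a; rewrite red E2.
Qed.

(** The defect of an adapted section and the base factor set have the same curvature, so their
    difference is central, hence a 2-cocycle. *)
Lemma cocycle_ext_surj (E : extension g h) :
  induces mubar E -> exists c, ext_iso (cocycle_ext c) E.
Proof.
move=> /induces_adapted[t0 [t1 adE]].
have [f [o [n df]]] := defect_exists adE.
have fs := defect_factor_set adE df.
have tw := twisted_cocycleD mA fs.1 (twisted_cocycleN mA L_twisted).
have [v1 v2 v3 v4 v5] := fs.2.
have [w1 w2 w3 w4 w5] := lift_curvature L.
have [|||c c2 [Ef Eo En]] := cochain2_exists (tw_phi tw) (tw_omega tw)
    (tw_alt tw) (tw_nu tw).
- move=> a; apply/mem_cen0; split=> v; rewrite ?br0E ?br1E.
    by rewrite -v1 -w1 subrr.
  by rewrite -v2 -w2 subrr.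
- move=> x y; apply/mem_cen0; split=> v; rewrite ?br0E ?br1E.
    by rewrite -v3 -w3 subrr.
  by rewrite -v4 -w4 subrr.
- by move=> x a; apply/mem_cen1 => v; rewrite !br1E -v5 -w5 subrr.
have cZ : is_cocycle (hatmu mubar s) 2 c.
  split=> //; apply/cocycle2P => //.
  have -> : cphi c = (fun a => f a - phi L a) by exact: funext.
  have -> : comega c = (fun x y => o x y - omega L x y).
    by apply: funext => x; exact: funext.
  have -> : cnu c = (fun x a => n x a - nu L x a).
    by apply: funext => x; exact: funext.
  exact: tw.
pose z : Z2 := exist _ c (introT (mem_mksub _ _) cZ).
exists z; apply: ext_iso_trans (defect_iso mA adE df fs).
(* The two factor sets agree pointwise, so the zero maps give an equivalence. *)
apply: (@equivalence_by_iso _ _ _ _ _ _ _ _ _ _ _ _ _ _ _ (fun=> 0) (fun=> 0)).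
have ll (U W : lmodType K) : linear (fun _ : U => 0 : W).
  by move=> k u v; rewrite scaler0 addr0.
split; try exact: ll.
- by move=> x v; rewrite br0E.
- by move=> x v; rewrite br1E.
- by move=> v a; rewrite br1E.
- move=> a; rewrite linear0 subr0 [cphi _ a]Ef; zmod.
- move=> x y; rewrite !(bilin0r (m0_bilin mA)) !subr0 [comega _ x y]Eo; zmod.
move=> x a; rewrite (bilin0r (m1_bilin mA)) (bilin0r (m_bilin mA)) !subr0.
by rewrite [cnu _ x a]En; zmod.
Qed.

Lemma extensions_parametrized :
  exists F : cohomology (hatmu mubar s) 2 -> ext_class mubar, bijective F.
Proof.
pose F (k : cohomology (hatmu mubar s) 2) : ext_class mubar :=
  exist _ (ext_iso (cocycle_ext (repr k)))
    (ex_intro2 _ _ (cocycle_ext (repr k)) (factor_set_induces _) erefl).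
have F_inj : injective F.
  move=> k k' /(congr1 sval)/= E.
  have : ext_iso (cocycle_ext (repr k)) (cocycle_ext (repr k')).
    by rewrite E; exact: ext_iso_refl.
  by move=> /cocycle_ext_iso; rewrite !reprP.
have F_surj C : exists k, F k = C.
  case: C => C [E indE CE]; have [c cE] := cocycle_ext_surj indE.
  exists (proj c).
  have CE' : ext_iso (cocycle_ext (repr (proj c : cohomology _ 2))) = C.
    rewrite CE; apply: ext_iso_eq; apply: ext_iso_trans cE.
    by apply/cocycle_ext_iso; rewrite reprP.
  (* An element of [ext_class] carries a proof; proof irrelevance reduces equality to that of the
     predicates. *)
  by case: _ / CE' in CE *; congr exist; exact: Prop_irrelevance.
exists F, (fun C => sval (cid (F_surj C))) => x; last exact: svalP (cid (F_surj x)).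
by apply: F_inj; exact: svalP (cid (F_surj (F x))).
Qed.
End Parametrization.

Theorem theorem6p4 (K : fieldType) (g h : lie2 K) (mubar : lie2_hom g (SOut h))
    (s : pi_section h) (mubar_ext : extensible mubar) :
  exists F : cohomology (hatmu mubar s) 2 -> ext_class mubar, bijective F.
Proof.
(* The potentials in [L] form the base factor set, which corresponds to the zero class; the section
   in [L] may differ from [s]. *)
have [L [H1 H2 H3 H4]] := mubar_ext.
apply: (@extensions_parametrized K g h mubar s L).
split.
- exact: linearP.
- exact: omega_bilin.
- exact: omega_alt.
- exact: nu_bilin.
- move=> a b; apply: eq_modulo (H1 a b) _; rewrite /flip /lift_map; zmod.
- move=> x a; apply: eq_modulo (H2 x a) _; rewrite /lift_act0; zmod.
- move=> x y z; apply: eq_modulo (H3 x y z) _; rewrite /lift_act0; zmod.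
move=> x y a; apply: eq_modulo (H4 x y a) _.
by rewrite /flip /lift_act1 /lift_map homfN !(bilinNr (nu_bilin L)); zmod.
Qed.
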